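(* Let $\lambda_1,\dots,\lambda_4\in\mathbb{R}$ be pairwise distinct constants and consider the system for functions $u,v$ of $(x^1,x^2,x^3,x^4)$ $$ \begin{aligned} &(\lambda_3-\lambda_4)(\lambda_1-\lambda_2)v_1u_2u_{34}+(\lambda_2-\lambda_3)(\lambda_1-\lambda_4)(v_1u_4u_{23}-v_3u_4u_{12}+v_3u_2u_{14})\\ &\quad-(\lambda_2-\lambda_4)(\lambda_1-\lambda_3)(v_1u_3u_{24}-v_4u_3u_{12}+v_4u_2u_{13})=0,\\ &(\lambda_3-\lambda_4)(\lambda_1-\lambda_2)v_1u_2v_{34}+(\lambda_2-\lambda_3)(\lambda_1-\lambda_4)(v_1u_4v_{23}-v_3u_4v_{12}+v_3u_2v_{14})\\ &\quad-(\lambda_2-\lambda_4)(\lambda_1-\lambda_3)(v_1u_3v_{24}-v_4u_3v_{12}+v_4u_2v_{13})=0 \end{aligned}\qquad (S) $$ (with $u_2v_1\neq0$). Let the flow $u_\tau=U$, $v_\tau=V$, where $U$ and $V$ are functions of the independent variables, jet variables intrinsic to (S), and some nonlocal variables over (S), be compatible with (S), and thus define a nonlocal symmetry with the characteristic $(U,V)$ for (S). Consider nonlocal variables $\zeta^1,\zeta^2$ defined by the relations $$[X_i^{(1)},S]=\big([X_i^{(0)},R]\big)^{TD},\qquad i=0,1,$$ where the vector fields $X_i^{(0)},X_i^{(1)}$ are those given in the context, $$R=-\frac{V}{v_1}\,\partial_{x^1}+\frac{U}{u_2}\,\partial_{x^2},\qquad S=\zeta^1\partial_{x^1}+\zeta^2\partial_{x^2},$$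 and the superscript $TD$ means that the derivatives $U_{x^i}$, $V_{x^j}$ of $U$ and $V$ are to be replaced by $D_{x^i}U$, $D_{x^j}V$, with $D_{x^i}$ the total derivatives. Then the new flow $$u_\sigma=\tilde U,\quad v_\sigma=\tilde V,\qquad \tilde U=u_2\zeta^2,\quad \tilde V=-v_1\zeta^1,$$ is also compatible with (S), and thus defines another nonlocal symmetry with the characteristic $(\tilde U,\tilde V)$ for (S). In other words, these relations define a recursion operator for (S), associating to any nonlocal symmetry with the characteristic $(U,V)$ a new (in general nonlocal) symmetry with the characteristic $(\tilde U,\tilde V)$.
   Context: Subscripts $i,j\in\{1,2,3,4\}$ on $u,v$ denote partial derivatives with respect to $x^i$; $[\cdot,\cdot]$ is the Lie bracket of vector fields. Define $$ \begin{aligned} X_0&=(\lambda-\lambda_1)\frac{\lambda_2-\lambda_4}{\lambda_1-\lambda_2}\frac{v_4}{v_1}\partial_{x^1}-(\lambda-\lambda_2)\frac{\lambda_1-\lambda_4}{\lambda_1-\lambda_2}\frac{u_4}{u_2}\partial_{x^2}+(\lambda-\lambda_4)\partial_{x^4},\\ X_1&=(\lambda-\lambda_1)\frac{\lambda_2-\lambda_3}{\lambda_1-\lambda_2}\frac{v_3}{v_1}\partial_{x^1}-(\lambda-\lambda_2)\frac{\lambda_1-\lambda_3}{\lambda_1-\lambda_2}\frac{u_3}{u_2}\partial_{x^2}+(\lambda-\lambda_3)\partial_{x^3}, \end{aligned} $$ and let $X_i^{(0)},X_i^{(1)}$ be the $\lambda$-independent vector fields determined by $X_i=X_i^{(0)}-\lambda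 X_i^{(1)}$, $i=0,1$. A nonlocal symmetry of (S) with characteristic $(U,V)$ means here a pair of functions $U,V$ of the independent variables, of $u,v$ and their derivatives (jet variables, modulo (S)), and of nonlocal variables over (S), i.e. extra dependent variables defined by relations for their derivatives (a differential covering over (S)), such that $U,V$ satisfy the linearization of (S): $\frac{d}{d\varepsilon}\big|_{\varepsilon=0}F^k[u+\varepsilon U,v+\varepsilon V]=0$, $k=1,2$ (where $F^1[u,v]=0$, $F^2[u,v]=0$ are the two equations of (S) and derivatives of $U,V$ are total derivatives), modulo (S), the equations defining the nonlocal variables, and differential consequences of these. Compatibility of the flow $u_\tau=U$, $v_\tau=V$ with (S) means the same thing. A recursion operator is understood as a B\''acklund auto-transformation for the linearized system, i.e. relations producing from a solution $(U,V)$ of the linearized system another solution $(\tilde U,\tilde V)$. *)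

(* Defs.v *)
From HB Require Import structures.
From mathcomp Require Import all_boot all_order all_algebra.
From mathcomp Require Import ring.
From mathcomp Require Import all_classical all_reals all_analysis.

Set Implicit Arguments.
Unset Strict Implicit.
Unset Printing Implicit Defensive.

Import Order.TTheory GRing.Theory Num.Theory.
Import numFieldNormedType.Exports.

Local Open Scope classical_set_scope.
Local Open Scope ring_scope.

(* The indices 1, 2, 3, 4 of the independent variables. *)
Definition d1 : 'I_4 := @Ordinal 4 0 isT.
Definition d2 : 'I_4 := @Ordinal 4 1 isT.
Definition d3 : 'I_4 := @Ordinal 4 2 isT.
Definition d4 : 'I_4 := @Ordinal 4 3 isT.

(* A multi-index a stands for the derivative of order a j in x^j. *)
Definition mindex := {ffun 'I_4 -> nat}.

Definition mshift (a : mindex) (i : 'I_4) : mindex :=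
  [ffun j => (a j + (j == i))%N].

Definition mseq (s : seq 'I_4) : mindex := [ffun j => count_mem j s].

(* Coordinates on the total space of a covering: independent variables, all    *)
(* the jet variables u_a and v_a, and nonlocal variables w_n indexed by N.     *)
Inductive jetcoord (N : Type) : Type :=
  | cx of 'I_4
  | cu of mindex
  | cv of mindex
  | cw of N.

Arguments cx {N} _.
Arguments cu {N} _.
Arguments cv {N} _.

Section CoordChoice.
Variable N : choiceType.

Definition coord_enc (c : jetcoord N) : ('I_4 + (mindex + mindex) + N)%type :=
  match c with
  | cx i => inl (inl i)
  | cu a => inl (inr (inl a))
  | cv a => inl (inr (inr a))
  | cw n => inr n
  end.

Definition coord_dec (e : ('I_4 + (mindex + mindex) + N)%type) : jetcoord N :=
  match e with
  | inl (inl i) => cx i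
  | inl (inr (inl a)) => cu a
  | inl (inr (inr a)) => cv a
  | inr n => cw n
  end.

Lemma coord_encK : cancel coord_enc coord_dec.
Proof. by case. Qed.

HB.instance Definition _ := Choice.copy (jetcoord N) (can_type coord_encK).

End CoordChoice.

(* Points carry the product topology. *)
Definition jetpoint (R : realType) (N : choiceType) : topologicalType :=
  {ptws jetcoord N -> R}.

Section Smooth.
Variables (R : realType) (N : choiceType).
Implicit Types (f : jetpoint R N -> R) (Om : set (jetpoint R N)).

Definition upd (p : jetpoint R N) (c : jetcoord N) (t : R) : jetpoint R N :=
  fun c' => if c' == c then t else p c'.

Definition pd (c : jetcoord N) f : jetpoint R N -> R :=
  fun p => derive1 (fun t => f (upd p c t)) (p c).

Definition iter_pd (cs : seq (jetcoord N)) f : jetpoint R N -> R := foldr pd f cs.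

Definition finite_dep Om f : Prop :=
  exists s : seq (jetcoord N), forall p q, Om p -> Om q ->
    (forall c, c \in s -> p c = q c) -> f p = f q.

(* Smooth functions on an open set Om: finitely many coordinates are involved, *)
(* and all iterated partial derivatives exist and are continuous. Values       *)
(* outside Om are irrelevant.                                                  *)
Definition smooth Om f : Prop :=
  finite_dep Om f /\
  forall (cs : seq (jetcoord N)) (p : jetpoint R N), Om p ->
    {for p, continuous (iter_pd cs f)} /\
    forall c, derivable (fun t : R => iter_pd cs f (upd p c t)) (p c) 1.

Definition uj (s : seq 'I_4) (p : jetpoint R N) : R := p (cu (mseq s)).
Definition vj (s : seq 'I_4) (p : jetpoint R N) : R := p (cv (mseq s)).

End Smooth.

(* Data of a differential covering: nonlocal variables w_n (possibly           *)
(* infinitely many), the open domain under consideration, and the right-hand   *)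
(* sides of the relations  d w_n / d x^i = nlrel n i.                          *)
Record covering (R : realType) := Covering {
  nlv : choiceType;
  cdom : set (jetpoint R nlv);
  nlrel : nlv -> 'I_4 -> jetpoint R nlv -> R
}.

Arguments cdom {R} c _.
Arguments nlrel {R} c _ _ _.

(* Left-hand side of the equations of the system, as an operator on the second *)
(* derivatives h, with du, dv the first derivatives of u and v.                *)
Definition opS (R : realType) (lam : 'I_4 -> R)
    (du dv : 'I_4 -> R) (h : 'I_4 -> 'I_4 -> R) : R :=
    (lam d3 - lam d4) * (lam d1 - lam d2) * (dv d1 * du d2 * h d3 d4)
  + (lam d2 - lam d3) * (lam d1 - lam d4) *
      (dv d1 * du d4 * h d2 d3 - dv d3 * du d4 * h d1 d2
       + dv d3 * du d2 * h d1 d4)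
  - (lam d2 - lam d4) * (lam d1 - lam d3) *
      (dv d1 * du d3 * h d2 d4 - dv d4 * du d3 * h d1 d2
       + dv d4 * du d2 * h d1 d3).

Definition F1 (R : realType) (lam : 'I_4 -> R) (du dv : 'I_4 -> R)
    (ddu ddv : 'I_4 -> 'I_4 -> R) : R := opS lam du dv ddu.

Definition F2 (R : realType) (lam : 'I_4 -> R) (du dv : 'I_4 -> R)
    (ddu ddv : 'I_4 -> 'I_4 -> R) : R := opS lam du dv ddv.

Section Covering.
Variables (R : realType) (lam : 'I_4 -> R) (C : covering R).
Local Notation N := (nlv C).
Local Notation pt := (jetpoint R N).
Implicit Types (f g U V : pt -> R).

Definition Dcoord (i : 'I_4) (c : jetcoord N) (p : pt) : R :=
  match c with
  | cx j => (j == i)%:R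
  | cu a => p (cu (mshift a i))
  | cv a => p (cv (mshift a i))
  | cw n => nlrel C n i p
  end.

(* Total derivative; the sum has finite support for smooth f. *)
Definition Dtot (i : 'I_4) f : pt -> R :=
  fun p => \sum_(c \in [set: jetcoord N]) Dcoord i c p * pd c f p.

Definition eval_sys
    (F : ('I_4 -> R) -> ('I_4 -> R) ->
         ('I_4 -> 'I_4 -> R) -> ('I_4 -> 'I_4 -> R) -> R) : pt -> R :=
  fun p => F (fun i => uj [:: i] p) (fun i => vj [:: i] p)
             (fun i j => uj [:: i; j] p) (fun i j => vj [:: i; j] p).

(* d/de at e = 0 of F[u + e U, v + e V], with total derivatives of U and V. *)
Definition linearize
    (F : ('I_4 -> R) -> ('I_4 -> R) ->
         ('I_4 -> 'I_4 -> R) -> ('I_4 -> 'I_4 -> R) -> R) U V : pt -> R :=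
  fun p => derive1 (fun e : R =>
    F (fun i => uj [:: i] p + e * Dtot i U p)
      (fun i => vj [:: i] p + e * Dtot i V p)
      (fun i j => uj [:: i; j] p + e * Dtot i (Dtot j U) p)
      (fun i j => vj [:: i; j] p + e * Dtot i (Dtot j V) p)) 0.

(* Functions on cdom C that vanish modulo the system and its differential      *)
(* consequences: the differential ideal generated by the two equations. The    *)
(* equations for the nonlocal variables need no generators, since they are     *)
(* built into Dtot.                                                            *)
Inductive mod_sys : (pt -> R) -> Prop :=
  | mod_F1 : mod_sys (eval_sys (F1 lam))
  | mod_F2 : mod_sys (eval_sys (F2 lam))
  | mod_add f g : mod_sys f -> mod_sys g -> mod_sys (f \+ g)
  | mod_mul g f : smooth (cdom C) g -> mod_sys f -> mod_sys (g \* f)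
  | mod_D i f : mod_sys f -> mod_sys (Dtot i f)
  | mod_ext f g :
      (forall p, cdom C p -> f p = g p) -> mod_sys f -> mod_sys g.

(* The relations for the nonlocal variables are compatible modulo the system:  *)
(* the total derivatives commute on the nonlocal variables.                    *)
Definition is_covering : Prop :=
  [/\ open (cdom C),
      forall p, cdom C p -> uj [:: d2] p * vj [:: d1] p != 0,
      forall n i, smooth (cdom C) (nlrel C n i)
    & forall n i j,
        mod_sys (Dtot i (nlrel C n j) \- Dtot j (nlrel C n i))].

Definition nonlocal_symmetry U V : Prop :=
  [/\ is_covering, smooth (cdom C) U, smooth (cdom C) V,
      mod_sys (linearize (F1 lam) U V) & mod_sys (linearize (F2 lam) U V)].

(* Vector fields  sum_i X i * d/dx^i  with coefficients on the covering. *)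
Definition vfield := 'I_4 -> pt -> R.

(* Lie bracket, x-derivatives of the coefficients being total derivatives. *)
Definition bracket (X Y : vfield) : vfield := fun k p =>
  \sum_(i < 4) (X i p * Dtot i (Y k) p - Y i p * Dtot i (X k) p).

(* Xlax d4 is X_0 and Xlax d3 is X_1; l is the spectral parameter. *)
Definition Xlax (k : 'I_4) (l : R) : vfield := fun i p =>
  if i == d1 then
    (l - lam d1) * ((lam d2 - lam k) / (lam d1 - lam d2))
      * (vj [:: k] p / vj [:: d1] p)
  else if i == d2 then
    - ((l - lam d2) * ((lam d1 - lam k) / (lam d1 - lam d2))
      * (uj [:: k] p / uj [:: d2] p))
  else if i == k then l - lam k
  else 0.

Definition Xlax0 (k : 'I_4) : vfield := Xlax k 0.
Definition Xlax1 (k : 'I_4) : vfield :=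
  fun i p => Xlax k 0 i p - Xlax k 1 i p.

(* This identity in l determines Xlax0 and Xlax1. *)
Lemma Xlax_split k l i p : Xlax k l i p = Xlax0 k i p - l * Xlax1 k i p.
Proof.
rewrite /Xlax1 /Xlax0 /Xlax; case: ifP => _; first by ring.
case: ifP => _; first by ring.
by case: ifP => _; ring.
Qed.

Definition Rfield U V : vfield := fun i p =>
  if i == d1 then - (V p / vj [:: d1] p)
  else if i == d2 then U p / uj [:: d2] p
  else 0.

Definition Sfield (z1 z2 : pt -> R) : vfield := fun i p =>
  if i == d1 then z1 p else if i == d2 then z2 p else 0.

(* [X_i^(1), S] = [X_i^(0), R]^TD for i = 0, 1, componentwise. *)
Definition zeta_relations U V (z1 z2 : pt -> R) : Prop :=
  forall k : 'I_4, k = d4 \/ k = d3 -> forall j : 'I_4,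
    mod_sys (bracket (Xlax1 k) (Sfield z1 z2) j
             \- bracket (Xlax0 k) (Rfield U V) j).

End Covering.

Arguments nonlocal_symmetry {R} lam C U V.
Arguments zeta_relations {R} lam C U V z1 z2.

(* Adding further nonlocal variables, indexed by M, to a covering. *)
Section Extension.
Variables (R : realType) (C : covering R) (M : choiceType).
Local Notation pt' := (jetpoint R (nlv C + M)%type).

Definition lift_coord (c : jetcoord (nlv C)) : jetcoord (nlv C + M)%type :=
  match c with
  | cx i => cx i
  | cu a => cu a
  | cv a => cv a
  | cw n => cw (inl n)
  end.

Definition forget (q : pt') : jetpoint R (nlv C) := fun c => q (lift_coord c).

Definition ext_cover (Om : set pt') (W : M -> 'I_4 -> pt' -> R) : covering R :=
  @Covering R (nlv C + M)%type Om (fun n i q =>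
    match n with
    | inl n => nlrel C n i (forget q)
    | inr m => W m i q
    end).

Definition covering_over (lam : 'I_4 -> R) (Om : set pt')
    (W : M -> 'I_4 -> pt' -> R) : Prop :=
  is_covering lam (ext_cover Om W) /\ forget @` Om = cdom C.

End Extension.

Arguments forget {R} C M q _.

(* Main.v *)
Require Import Defs.
From HB Require Import structures.
From mathcomp Require Import all_boot all_order all_algebra.
From mathcomp Require Import ring lra.
From mathcomp Require Import all_classical all_reals all_analysis.

Set Implicit Arguments.
Unset Strict Implicit.
Unset Printing Implicit Defensive.

Import Order.TTheory GRing.Theory Num.Theory.
Import numFieldNormedType.Exports.

Local Open Scope classical_set_scope.
Local Open Scope ring_scope.

(** Why the theorem holds.  Up to sign the fields X_i^(1) and X_i^(0) are

      A_k = al_k d/dx1 + be_k d/dx2 + d/dxk,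
      B_k = l1 al_k d/dx1 + l2 be_k d/dx2 + lk d/dxk       (k = 3, 4),

    with al_k = a_k v_k / v_1, be_k = - (1 + a_k) u_k / u_2 and
    a_k = (l2 - lk) / (l1 - l2).  Modulo the system the pencil commutes:
    [A3, A4] = 0, [B3, B4] = 0 and [A3, B4] + [B3, A4] = 0; indeed every
    coefficient of these brackets is a multiple of one of the two equations
    (curv1E, curv2E, curvB1E, curvB2E).  For a field X in the span of d/dx1 and
    d/dx2 put

      E(X) = [A3, [B4, X]] - [A4, [B3, X]]                 (symop).

    - If X = r1 d/dx1 + r2 d/dx2, the two coefficients of E(X) are, modulo the
      system, invertible multiples of the two linearized equations evaluated at
      U = u_2 r2, V = - v_1 r1 (symop_linearization).  Hence (U, V) is a
      symmetry if and only if E vanishes on R.  The reason is that the variations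
      of al_k and be_k along the flow are, up to a constant factor and a term that
      drops out of E, coefficients of [B_k - l2 A_k, R] and [B_k - l1 A_k, R].

    - If [A_k, S] = [B_k, R] for k = 3, 4, then E(S) = 0: the Jacobi identity
      and the commutation of the pencil turn E(S) into
      [B4, [B3, R]] - [B3, [B4, R]], which is 0 (symop_recursion).  So the new
      flow is a symmetry (new_symmetry).

    - The relations [A_k, S] = [B_k, R] express the derivatives of zeta^1,
      zeta^2 in x3 and x4 through those in x1 and x2.  Taking as nonlocal
      variables all derivatives of zeta^1, zeta^2 in x1 and x2, the only
      compatibility condition which is not automatic is the one in x3, x4, and
      by the Jacobi identity again (obstruction) it amounts to E(R) = 0, which
      holds because (U, V) is a symmetry.

    These computations take place in the quotient of the ring of smooth functions
    by the differential ideal of the system (jetring), on which the total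
    derivatives act as derivations.  They commute there as soon as they do on the
    nonlocal variables (mod_sys_comm); this uses the symmetry of second partial
    derivatives of smooth functions on the jet space (pdC). *)

(** * Vector fields over a ring with four derivations *)

(** The derivations commute pairwise on f.  They need not commute everywhere:
    on nonlocal variables this is what has to be proved. *)
Definition commute_on (Q : Type) (D : 'I_4 -> Q -> Q) (f : Q) : Prop :=
  forall i j, D i (D j f) = D j (D i f).

Lemma ord4P (i : 'I_4) : [\/ i = d1, i = d2, i = d3 | i = d4].
Proof.
case: i => -[|[|[|[|//]]]] h; [exact: Or41 (val_inj _)|exact: Or42 (val_inj _)|
  exact: Or43 (val_inj _)|exact: Or44 (val_inj _)].
Qed.

Section DiffAlgebra.
Variables (Q : comPzRingType) (D : 'I_4 -> Q -> Q).
Hypothesis DD : forall i f g, D i (f + g) = D i f + D i g.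
Hypothesis DM : forall i f g, D i (f * g) = D i f * g + f * D i g.

Lemma der0 i : D i 0 = 0.
Proof. by apply: (addrI (D i 0)); rewrite -DD !addr0. Qed.

Lemma derN i f : D i (- f) = - D i f.
Proof. by apply/eqP; rewrite -subr_eq0 opprK -DD addNr der0. Qed.

Lemma derB i f g : D i (f - g) = D i f - D i g.
Proof. by rewrite DD derN. Qed.

Lemma der1 i : D i 1 = 0.
Proof.
by apply: (addrI (D i 1)); rewrite addr0 -{3}[1](mulr1 1) DM mulr1 mul1r.
Qed.

Lemma der_inv i f g : f * g = 1 -> D i f = - (f * f * D i g).
Proof.
move=> fg; have := DM i f g; rewrite fg der1 => h.
have -> : D i f = f * (D i f * g) by rewrite mulrCA fg mulr1.
have -> : D i f * g = - (f * D i g) by apply/eqP; rewrite -addr_eq0 -h.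
by ring.
Qed.

Lemma der_sum i n (F : 'I_n -> Q) : D i (\sum_j F j) = \sum_j D i (F j).
Proof. exact: (big_morph _ (DD i) (der0 i)). Qed.

(** Derivative of f along the vector field with components X. *)
Definition dirder (X : 'I_4 -> Q) (f : Q) : Q := \sum_i X i * D i f.

(** Lie bracket of vector fields. *)
Definition lie (X Y : 'I_4 -> Q) : 'I_4 -> Q :=
  fun k => dirder X (Y k) - dirder Y (X k).

Lemma dirderB X f g : dirder X (f - g) = dirder X f - dirder X g.
Proof.
by rewrite /dirder -sumrB; apply: eq_bigr => i _; rewrite derB mulrBr.
Qed.

Lemma eq_dirder X Y f : X =1 Y -> dirder X f = dirder Y f.
Proof. by move=> XY; apply: eq_bigr => i _; rewrite XY. Qed.

Lemma eq_lie X X' Y Y' : X =1 X' -> Y =1 Y' -> lie X Y =1 lie X' Y'.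
Proof.
by move=> eX eY k; rewrite /lie (eq_dirder _ eX) (eq_dirder _ eY) eX eY.
Qed.

Lemma dirderN X f : dirder (fun i => - X i) f = - dirder X f.
Proof. by rewrite /dirder -sumrN; apply: eq_bigr => i _; rewrite mulNr. Qed.

Lemma lieN X Y k : lie (fun i => - X i) Y k = - lie X Y k.
Proof.
have h : dirder Y (- X k) = - dirder Y (X k).
  by rewrite /dirder -sumrN; apply: eq_bigr => i _; rewrite derN mulrN.
by rewrite /lie dirderN h opprB opprK addrC.
Qed.

Lemma lieNr X Y k : lie X (fun i => - Y i) k = - lie X Y k.
Proof.
have h : dirder X (- Y k) = - dirder X (Y k).
  by rewrite /dirder -sumrN; apply: eq_bigr => i _; rewrite derN mulrN.
by rewrite /lie dirderN h opprB opprK addrC.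
Qed.

Lemma dirder_lie X Y f :
  dirder X (dirder Y f) - dirder Y (dirder X f) =
  dirder (lie X Y) f
  + \sum_i \sum_j X i * Y j * (D i (D j f) - D j (D i f)).
Proof.
have e Z T : dirder Z (dirder T f) =
    \sum_j dirder Z (T j) * D j f + \sum_i \sum_j Z i * T j * D i (D j f).
  rewrite /dirder.
  under [X in X + _]eq_bigr do rewrite mulr_suml.
  rewrite [X in X + _]exchange_big /= -big_split /=; apply: eq_bigr => i _.
  rewrite der_sum mulr_sumr -big_split /=; apply: eq_bigr => j _.
  by rewrite DM mulrDr !mulrA.
rewrite !e opprD addrACA; congr (_ + _).
  by rewrite -sumrB; apply: eq_bigr => j _; rewrite mulrBl.
rewrite [X in _ - X]exchange_big -sumrB; apply: eq_bigr => i _ /=.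
by rewrite -sumrB; apply: eq_bigr => j _; ring.
Qed.

Lemma dirder_lie0 X Y f : commute_on D f ->
  dirder (lie X Y) f = dirder X (dirder Y f) - dirder Y (dirder X f).
Proof.
move=> cf; rewrite dirder_lie big1 ?addr0// => i _; rewrite big1// => j _.
by rewrite cf subrr mulr0.
Qed.

(** Jacobi identity, corrected by the commutators of the derivations on Z. *)
Lemma jacobi X Y Z k : commute_on D (X k) -> commute_on D (Y k) ->
  lie X (lie Y Z) k - lie Y (lie X Z) k =
  lie (lie X Y) Z k
  + \sum_i \sum_j X i * Y j * (D i (D j (Z k)) - D j (D i (Z k))).
Proof.
move=> cX cY; have h := dirder_lie X Y (Z k).
have e T S (W : 'I_4 -> Q) : lie T (lie S W) k =
    dirder T (dirder S (W k)) - dirder T (dirder W (S k))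
    - dirder (lie S W) (T k) by rewrite {1}/lie dirderB.
have -> : lie (lie X Y) Z k = dirder (lie X Y) (Z k)
    - (dirder Z (dirder X (Y k)) - dirder Z (dirder Y (X k))).
  by rewrite {1}/lie [dirder Z (lie _ _ _)]dirderB.
rewrite !e (dirder_lie0 _ _ cX) (dirder_lie0 _ _ cY).
move/eqP: h; rewrite -subr_eq0 => /eqP h.
by apply/eqP; rewrite -subr_eq0 -[X in _ == X]h; apply/eqP; ring.
Qed.

(** The field a d/dx1 + b d/dx2. *)
Definition vert (a b : Q) : 'I_4 -> Q :=
  fun i => if i == d1 then a else if i == d2 then b else 0.
(** The field a d/dx1 + b d/dx2 + c d/dxk, for k = 3, 4. *)
Definition horiz (k : 'I_4) (a b c : Q) : 'I_4 -> Q :=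
  fun i => if i == d1 then a else if i == d2 then b else if i == k then c
           else 0.

Lemma sum4 (F : 'I_4 -> Q) : \sum_i F i = F d1 + F d2 + F d3 + F d4.
Proof.
rewrite !big_ord_recl big_ord0 addr0 !addrA.
by congr (F _ + F _ + F _ + F _); apply: val_inj.
Qed.

Lemma dirder_vert a b f : dirder (vert a b) f = a * D d1 f + b * D d2 f.
Proof. by rewrite /dirder sum4 /vert /= !mul0r !addr0. Qed.

Lemma dirder_horiz k a b c f : k = d4 \/ k = d3 ->
  dirder (horiz k a b c) f = a * D d1 f + b * D d2 f + c * D k f.
Proof.
by case=> ->; rewrite /dirder sum4 /horiz /= !mul0r !addr0.
Qed.

Lemma lie_horiz_vert k x y z r1 r2 : k = d4 \/ k = d3 -> D d1 z = 0 -> D d2 z = 0 ->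
  lie (horiz k x y z) (vert r1 r2) =1
  vert (dirder (horiz k x y z) r1 - (r1 * D d1 x + r2 * D d2 x))
       (dirder (horiz k x y z) r2 - (r1 * D d1 y + r2 * D d2 y)).
Proof.
move=> hk z1 z2 i; rewrite /lie !dirder_vert /vert {2 3}/horiz.
have [//|_] := eqVneq i d1; have [//|_] := eqVneq i d2.
have -> : dirder (horiz k x y z) 0 = 0.
  by rewrite /dirder big1// => j _; rewrite der0 mulr0.
by case: eqP => _; rewrite ?z1 ?z2 ?der0 !mulr0 addr0 subr0.
Qed.

(** * The operator of the system and the pencil of vector fields *)

(** The left-hand side of the two equations, over an arbitrary ring. *)
Definition sysop (l : 'I_4 -> Q) (du dv : 'I_4 -> Q) (h : 'I_4 -> 'I_4 -> Q) :=
    (l d3 - l d4) * (l d1 - l d2) * (dv d1 * du d2 * h d3 d4)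
  + (l d2 - l d3) * (l d1 - l d4) *
      (dv d1 * du d4 * h d2 d3 - dv d3 * du d4 * h d1 d2
       + dv d3 * du d2 * h d1 d4)
  - (l d2 - l d4) * (l d1 - l d3) *
      (dv d1 * du d3 * h d2 d4 - dv d4 * du d3 * h d1 d2
       + dv d4 * du d2 * h d1 d3).

(** Derivative of sysop at (du, dv, h) in the direction (eu, ev, k). *)
Definition sysop_lin (l : 'I_4 -> Q) (du dv eu ev : 'I_4 -> Q)
    (h k : 'I_4 -> 'I_4 -> Q) :=
    (l d3 - l d4) * (l d1 - l d2) *
      (ev d1 * du d2 * h d3 d4 + dv d1 * eu d2 * h d3 d4
       + dv d1 * du d2 * k d3 d4)
  + (l d2 - l d3) * (l d1 - l d4) *
      (ev d1 * du d4 * h d2 d3 + dv d1 * eu d4 * h d2 d3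
       + dv d1 * du d4 * k d2 d3
       - (ev d3 * du d4 * h d1 d2 + dv d3 * eu d4 * h d1 d2
          + dv d3 * du d4 * k d1 d2)
       + (ev d3 * du d2 * h d1 d4 + dv d3 * eu d2 * h d1 d4
          + dv d3 * du d2 * k d1 d4))
  - (l d2 - l d4) * (l d1 - l d3) *
      (ev d1 * du d3 * h d2 d4 + dv d1 * eu d3 * h d2 d4
       + dv d1 * du d3 * k d2 d4
       - (ev d4 * du d3 * h d1 d2 + dv d4 * eu d3 * h d1 d2
          + dv d4 * du d3 * k d1 d2)
       + (ev d4 * du d2 * h d1 d3 + dv d4 * eu d2 * h d1 d3
          + dv d4 * du d2 * k d1 d3)).

Section Pencil.
(* The elements a k = (l2 - lk) / (l1 - l2) are given by the equations they  *)
(* satisfy, as the ring has no division.                                     *)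
Variables (l a : 'I_4 -> Q).
Hypothesis Dl : forall i j, D i (l j) = 0.
Hypothesis Da : forall i j, D i (a j) = 0.
Let m := l d1 - l d2.
Hypothesis la3 : l d3 = l d2 - m * a d3.
Hypothesis la4 : l d4 = l d2 - m * a d4.

Variables al be : 'I_4 -> Q.

(** The pencil: fieldA k and fieldB k are the fields A_k and B_k, the opposites
    of X_i^(1) and X_i^(0), with arbitrary coefficients al and be. *)
Definition fieldA k := horiz k (al k) (be k) 1.
Definition fieldB k := horiz k (l d1 * al k) (l d2 * be k) (l k).

(** First two components of [A3, A4]; the other two vanish. *)
Definition curv1 := dirder (fieldA d3) (al d4) - dirder (fieldA d4) (al d3).
Definition curv2 := dirder (fieldA d3) (be d4) - dirder (fieldA d4) (be d3).

Lemma Dm i : D i m = 0. Proof. by rewrite derB !Dl subrr. Qed.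

(** First two components of [B3, B4], divided by l1 and l2. *)
Definition curvB1 := dirder (fieldB d3) (al d4) - dirder (fieldB d4) (al d3).
Definition curvB2 := dirder (fieldB d3) (be d4) - dirder (fieldB d4) (be d3).

Lemma dirder_A k f : k = d4 \/ k = d3 ->
  dirder (fieldA k) f = al k * D d1 f + be k * D d2 f + D k f.
Proof. by move=> hk; rewrite dirder_horiz// mul1r. Qed.

Lemma dirder_B k f : k = d4 \/ k = d3 ->
  dirder (fieldB k) f =
  l d1 * al k * D d1 f + l d2 * be k * D d2 f + l k * D k f.
Proof. by move=> hk; rewrite dirder_horiz. Qed.

Let h3 : d3 = d4 \/ d3 = d3 := or_intror erefl.
Let h4 : d4 = d4 \/ d4 = d3 := or_introl erefl.

Lemma dirder_const X c : (forall i, D i c = 0) -> dirder X c = 0.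
Proof. by move=> h; rewrite /dirder big1// => i _; rewrite h mulr0. Qed.

Lemma lie0 W i : lie (fun=> 0) W i = 0.
Proof.
rewrite /lie [dirder W _]dirder_const; last by move=> j; rewrite der0.
by rewrite subr0 /dirder big1// => j _; rewrite mul0r.
Qed.

Lemma dirder_constM X c f : (forall i, D i c = 0) ->
  dirder X (c * f) = c * dirder X f.
Proof.
move=> h; rewrite /dirder mulr_sumr; apply: eq_bigr => i _.
by rewrite DM h mul0r add0r mulrCA.
Qed.

Lemma fieldA_const j k : k != d1 -> k != d2 -> forall i, D i (fieldA j k) = 0.
Proof.
move=> /negbTE n1 /negbTE n2 i; rewrite /fieldA /horiz n1 n2.
by case: eqP => _; rewrite ?der1 ?der0.
Qed.

Lemma fieldB_const j k : k != d1 -> k != d2 -> forall i, D i (fieldB j k) = 0.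
Proof.
move=> /negbTE n1 /negbTE n2 i; rewrite /fieldB /horiz n1 n2.
by case: eqP => _; rewrite ?Dl ?der0.
Qed.

Lemma lieA : lie (fieldA d3) (fieldA d4) =1 vert curv1 curv2.
Proof.
move=> k; rewrite /lie /vert /curv1 /curv2.
have [->|n1] := eqVneq k d1; first by [].
have [->|n2] := eqVneq k d2; first by [].
by rewrite !(dirder_const _ (fieldA_const _ n1 n2)) subrr.
Qed.

Lemma lieB : lie (fieldB d3) (fieldB d4) =1 vert (l d1 * curvB1) (l d2 * curvB2).
Proof.
move=> k; rewrite /lie /vert /curvB1 /curvB2 !mulrBr -!dirder_constM//.
have [->|n1] := eqVneq k d1; first by [].
have [->|n2] := eqVneq k d2; first by [].
by rewrite !(dirder_const _ (fieldB_const _ n1 n2)) subrr.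
Qed.

Lemma lieAB k : lie (fieldA d3) (fieldB d4) k + lie (fieldB d3) (fieldA d4) k =
  vert (l d1 * curv1 + curvB1) (l d2 * curv2 + curvB2) k.
Proof.
rewrite /lie /vert /curv1 /curv2 /curvB1 /curvB2 !mulrBr -!dirder_constM//.
have [->|n1] := eqVneq k d1; first by rewrite /fieldA /fieldB /horiz /=; ring.
have [->|n2] := eqVneq k d2; first by rewrite /fieldA /fieldB /horiz /=; ring.
rewrite !(dirder_const _ (fieldB_const _ n1 n2)).
by rewrite !(dirder_const _ (fieldA_const _ n1 n2)); ring.
Qed.

Section Existence.
Hypotheses (cal : forall k, commute_on D (al k))
           (cbe : forall k, commute_on D (be k)).

Lemma commute_const c : (forall i, D i c = 0) -> commute_on D c.
Proof. by move=> h i j; rewrite !h !der0. Qed.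

Lemma commute_fieldA j k : commute_on D (fieldA j k).
Proof.
have [n1|n1] := boolP (k == d1); first by rewrite /fieldA /horiz n1.
have [n2|n2] := boolP (k == d2).
  by rewrite /fieldA /horiz (negbTE n1) n2.
exact/commute_const/fieldA_const.
Qed.

(** When [A3, A4] = 0 and all derivations but those in x3 and x4 are known to
    commute on S k, the remaining commutator is [A3, [A4, S]] - [A4, [A3, S]]:
    it measures the obstruction to prescribing [A3, S] and [A4, S]. *)
Lemma obstruction (S : 'I_4 -> Q) k : curv1 = 0 -> curv2 = 0 ->
  (forall i j, (i, j) <> (d3, d4) -> (i, j) <> (d4, d3) ->
     D i (D j (S k)) = D j (D i (S k))) ->
  D d3 (D d4 (S k)) - D d4 (D d3 (S k)) =
  lie (fieldA d3) (lie (fieldA d4) S) k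
  - lie (fieldA d4) (lie (fieldA d3) S) k.
Proof.
move=> c1 c2 cS; rewrite jacobi; [|exact: commute_fieldA..].
have -> : lie (lie (fieldA d3) (fieldA d4)) S k = 0.
  have e : lie (fieldA d3) (fieldA d4) =1 fun=> 0.
    by move=> i; rewrite lieA c1 c2 /vert; do 2 case: eqP => // _.
  by rewrite (eq_lie e (fun=> erefl)) lie0.
rewrite add0r (bigD1 d3)//= (bigD1 d4)//= !big1 ?addr0.
- by rewrite /fieldA /horiz /= !mul1r.
- move=> i i3; rewrite big1// => j _.
  have [/eqP [-> ->]|ij] := boolP ((i, j) == (d4, d3)).
    by rewrite {1}/fieldA /horiz /= !mul0r.
  rewrite cS ?subrr ?mulr0//; last exact/eqP.
  by case=> ? _; subst; rewrite eqxx in i3.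
- move=> j j4; rewrite cS ?subrr ?mulr0//.
  by case=> h; subst; rewrite eqxx in j4.
Qed.
End Existence.

Hypothesis DC : forall f, commute_on D f.
(* Oriented instances of DC, which sort iterated derivatives. *)
Let D21 f : D d2 (D d1 f) = D d1 (D d2 f). Proof. exact: DC. Qed.
Let D31 f : D d3 (D d1 f) = D d1 (D d3 f). Proof. exact: DC. Qed.
Let D32 f : D d3 (D d2 f) = D d2 (D d3 f). Proof. exact: DC. Qed.
Let D41 f : D d4 (D d1 f) = D d1 (D d4 f). Proof. exact: DC. Qed.
Let D42 f : D d4 (D d2 f) = D d2 (D d4 f). Proof. exact: DC. Qed.
Let D43 f : D d4 (D d3 f) = D d3 (D d4 f). Proof. exact: DC. Qed.

(** The operator E(X) = [A3, [B4, X]] - [A4, [B3, X]], whose vanishing on a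
    field in the span of d/dx1 and d/dx2 characterizes symmetries. *)
Definition symop (X : 'I_4 -> Q) : 'I_4 -> Q := fun k =>
  lie (fieldA d3) (lie (fieldB d4) X) k
  - lie (fieldA d4) (lie (fieldB d3) X) k.

Lemma symop_opp X k :
  - lie (fieldA d3) (fun i => - lie (fieldB d4) X i) k
  - - lie (fieldA d4) (fun i => - lie (fieldB d3) X i) k = symop X k.
Proof. by rewrite /symop !lieNr !opprK. Qed.

(** If the pencil commutes, every solution Y of [A_k, Y] = [B_k, X] satisfies
    E(Y) = 0, whatever X is. *)
Lemma symop_recursion (X Y : 'I_4 -> Q) :
  curv1 = 0 -> curv2 = 0 -> curvB1 = 0 -> curvB2 = 0 ->
  lie (fieldA d3) Y =1 lie (fieldB d3) X ->
  lie (fieldA d4) Y =1 lie (fieldB d4) X ->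
  symop Y =1 fun=> 0.
Proof.
move=> c1 c2 b1 b2 e3 e4 k; rewrite /symop.
have jac Z T W i : lie Z (lie T W) i = lie T (lie Z W) i + lie (lie Z T) W i.
  apply/eqP; rewrite addrC -subr_eq jacobi// -subr_eq0 addrAC subrr add0r.
  by rewrite big1// => p _; rewrite big1// => q _; rewrite DC subrr mulr0.
have v0 : vert 0 0 =1 fun=> 0 by move=> i; rewrite /vert; do 2 case: eqP => // _.
have eB : lie (fieldB d3) (fieldB d4) =1 fun=> 0.
  by move=> i; rewrite lieB b1 b2 !mulr0 v0.
have eAB : lie (fieldA d3) (fieldB d4) =1 lie (fieldA d4) (fieldB d3).
  move=> i; have := lieAB i; rewrite c1 c2 b1 b2 !mulr0 addr0 v0 => /eqP.
  by rewrite addr_eq0 => /eqP ->; rewrite /lie opprB.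
rewrite (jac (fieldA d3)) (jac (fieldA d4)) (eq_lie eAB (fun=> erefl)).
rewrite (eq_lie (fun=> erefl) e3) (eq_lie (fun=> erefl) e4).
rewrite (jac (fieldB d3)) (eq_lie eB (fun=> erefl)) lie0.
by ring.
Qed.

Section Variation.
Variables r1 r2 : Q.

(** Variations of al_k = a_k v_k / v_1 and be_k = - (1 + a_k) u_k / u_2 along the
    flow u_tau = u_2 r2, v_tau = - v_1 r1, written in terms of al, be, r1, r2. *)
Definition dal k := - (a k * D k r1) + al k * D d1 r1 - r1 * D d1 (al k).
Definition dbe k :=
  - ((1 + a k) * D k r2) - be k * D d2 r2 + r2 * D d2 (be k).

(** The induced variations of curv1 and curv2. *)
Definition dcurv1 :=
    dal d3 * D d1 (al d4) + dbe d3 * D d2 (al d4) + dirder (fieldA d3) (dal d4)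
  - (dal d4 * D d1 (al d3) + dbe d4 * D d2 (al d3)
     + dirder (fieldA d4) (dal d3)).
Definition dcurv2 :=
    dal d3 * D d1 (be d4) + dbe d3 * D d2 (be d4) + dirder (fieldA d3) (dbe d4)
  - (dal d4 * D d1 (be d3) + dbe d4 * D d2 (be d3)
     + dirder (fieldA d4) (dbe d3)).

(** E(R) is the variation of the curvature, up to multiples of the curvature and
    of its derivatives. *)
Lemma symop_vert : symop (vert r1 r2) =1 vert
  (m * (dcurv1 - r2 * D d2 curv1)
   + l d2 * (curv1 * D d1 r1 + curv2 * D d2 r1
             - r1 * D d1 curv1 - r2 * D d2 curv1))
  (m * (dcurv2 + r1 * D d1 curv2)
   + l d1 * (curv1 * D d1 r2 + curv2 * D d2 r2
             - r1 * D d1 curv2 - r2 * D d2 curv2)).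
Proof.
move=> k; rewrite /symop.
rewrite (eq_lie (fun=> erefl) (lie_horiz_vert _ _ _ _ h4 (Dl _ _) (Dl _ _))).
rewrite (eq_lie (fun=> erefl) (lie_horiz_vert _ _ _ _ h3 (Dl _ _) (Dl _ _))).
rewrite (lie_horiz_vert _ _ _ _ h3 (der1 _) (der1 _)).
rewrite (lie_horiz_vert _ _ _ _ h4 (der1 _) (der1 _)).
rewrite /vert; have [_|_] := eqVneq k d1; last first.
  have [_|_] := eqVneq k d2; last by rewrite subrr.
  rewrite /curv1 /curv2 /dcurv2.
  rewrite !(dirder_A _ h3, dirder_A _ h4, dirder_horiz _ _ _ _ h3,
            dirder_horiz _ _ _ _ h4) /dal /dbe.
  rewrite !(derB, derN, DD, DM, Dl, Da, Dm, der1) ?der0 la3 la4.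
  by rewrite !(D21, D31, D32, D41, D42, D43) /m; ring.
rewrite /curv1 /curv2 /dcurv1.
rewrite !(dirder_A _ h3, dirder_A _ h4, dirder_horiz _ _ _ _ h3,
          dirder_horiz _ _ _ _ h4) /dal /dbe.
rewrite !(derB, derN, DD, DM, Dl, Da, Dm, der1) ?der0 la3 la4.
by rewrite !(D21, D31, D32, D41, D42, D43) /m; ring.
Qed.
End Variation.
End Pencil.

(** * The coefficients of the pencil, and linearization *)
Section System.
Variables (l a : 'I_4 -> Q).
Hypothesis Dl : forall i j, D i (l j) = 0.
Hypothesis Da : forall i j, D i (a j) = 0.
Let m := l d1 - l d2.
Hypothesis la3 : l d3 = l d2 - m * a d3.
Hypothesis la4 : l d4 = l d2 - m * a d4.
Variables u v iu iv : Q.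
Hypotheses (iuP : iu * D d2 u = 1) (ivP : iv * D d1 v = 1).
Hypotheses (cu : commute_on D u) (cv : commute_on D v).

(** The coefficients al_k and be_k; iu and iv are the inverses of u_2, v_1. *)
Definition coefal k := a k * (D k v * iv).
Definition coefbe k := - ((1 + a k) * (D k u * iu)).

Let h3 : d3 = d4 \/ d3 = d3 := or_intror erefl.
Let h4 : d4 = d4 \/ d4 = d3 := or_introl erefl.
Let Du i := D i u.
Let Dv i := D i v.
Let DDu i j := D i (D j u).
Let DDv i j := D i (D j v).

Lemma curv1E : m ^+ 2 * curv1 coefal coefbe =
  iu * iv ^+ 2 * sysop l Du Dv DDv.
Proof.
rewrite /curv1 (dirder_A _ _ _ h3) (dirder_A _ _ _ h4) /coefal /coefbe /sysop.
rewrite !(DM, Da) !(der_inv _ ivP) la3 la4 /Du /Dv /DDv /m.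
rewrite !(cv d2 d1, cv d3 d1, cv d4 d1, cv d3 d2, cv d4 d2, cv d4 d3).
by ring: iuP ivP.
Qed.

Lemma curv2E : m ^+ 2 * curv2 coefal coefbe =
  - (iu ^+ 2 * iv * sysop l Du Dv DDu).
Proof.
rewrite /curv2 (dirder_A _ _ _ h3) (dirder_A _ _ _ h4) /coefal /coefbe /sysop.
rewrite !(derN, DM, DD, Da, der1) !(der_inv _ iuP) la3 la4 /Du /Dv /DDu /m.
rewrite !(cu d2 d1, cu d3 d1, cu d4 d1, cu d3 d2, cu d4 d2, cu d4 d3).
by ring: iuP ivP.
Qed.

Lemma curvB1E : curvB1 l coefal coefbe = l d2 * curv1 coefal coefbe.
Proof.
rewrite /curvB1 /curv1 (dirder_A _ _ _ h3) (dirder_A _ _ _ h4).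
rewrite (dirder_B _ _ _ _ h3) (dirder_B _ _ _ _ h4) /coefal /coefbe.
rewrite !(derN, DM, DD, Da, der1) !(der_inv _ ivP) la3 la4 /m.
rewrite !(cv d2 d1, cv d3 d1, cv d4 d1, cv d3 d2, cv d4 d2, cv d4 d3).
by ring: iuP ivP.
Qed.

Lemma curvB2E : curvB2 l coefal coefbe = l d1 * curv2 coefal coefbe.
Proof.
rewrite /curvB2 /curv2 (dirder_A _ _ _ h3) (dirder_A _ _ _ h4).
rewrite (dirder_B _ _ _ _ h3) (dirder_B _ _ _ _ h4) /coefal /coefbe.
rewrite !(derN, DM, DD, Da, der1) !(der_inv _ iuP) la3 la4 /m.
rewrite !(cu d2 d1, cu d3 d1, cu d4 d1, cu d3 d2, cu d4 d2, cu d4 d3).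
by ring: iuP ivP.
Qed.

Variable m_inv : Q.
Hypothesis m_invP : m_inv * m = 1.
Hypotheses (eqv : sysop l Du Dv DDv = 0) (equ : sysop l Du Dv DDu = 0).

Lemma cancelm x : m * x = 0 -> x = 0.
Proof. by move=> h; rewrite -[x]mul1r -m_invP -mulrA h mulr0. Qed.

Lemma curv1_eq0 : curv1 coefal coefbe = 0.
Proof. by do 2 apply: cancelm; rewrite mulrA -expr2 curv1E eqv mulr0. Qed.

Lemma curv2_eq0 : curv2 coefal coefbe = 0.
Proof. by do 2 apply: cancelm; rewrite mulrA -expr2 curv2E equ mulr0 oppr0. Qed.

Lemma curvB1_eq0 : curvB1 l coefal coefbe = 0.
Proof. by rewrite curvB1E curv1_eq0 mulr0. Qed.

Lemma curvB2_eq0 : curvB2 l coefal coefbe = 0.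
Proof. by rewrite curvB2E curv2_eq0 mulr0. Qed.

Section Linearization.
Hypothesis DC : forall f, commute_on D f.
Let D21 f : D d2 (D d1 f) = D d1 (D d2 f). Proof. exact: DC. Qed.
Let D31 f : D d3 (D d1 f) = D d1 (D d3 f). Proof. exact: DC. Qed.
Let D32 f : D d3 (D d2 f) = D d2 (D d3 f). Proof. exact: DC. Qed.
Let D41 f : D d4 (D d1 f) = D d1 (D d4 f). Proof. exact: DC. Qed.
Let D42 f : D d4 (D d2 f) = D d2 (D d4 f). Proof. exact: DC. Qed.
Let D43 f : D d4 (D d3 f) = D d3 (D d4 f). Proof. exact: DC. Qed.

Variables r1 r2 : Q.
Let U := D d2 u * r2.
Let V := - (D d1 v * r1).
Let DU i := D i U.
Let DV i := D i V.
Let DDU i j := D i (D j U).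
Let DDV i j := D i (D j V).

Lemma dcurv1E : m ^+ 2 * dcurv1 a coefal coefbe r1 r2 =
  iu * iv ^+ 2 * sysop_lin l Du Dv DU DV DDv DDV
  - (iu ^+ 2 * iv ^+ 2 * DU d2 + 2%:R * iu * iv ^+ 3 * DV d1)
    * sysop l Du Dv DDv.
Proof.
rewrite /dcurv1 (dirder_A _ _ _ h3) (dirder_A _ _ _ h4) /dal /dbe.
rewrite /coefal /coefbe /sysop /sysop_lin /DU /DV /DDV /U /V la3 la4 /Du /Dv /DDv /m.
rewrite !(derN, derB, DM, DD, Da, der1, der0).
rewrite !(der_inv _ iuP, der_inv _ ivP).
rewrite !(derN, derB, DM, DD, Da, der1, der0).
rewrite !(der_inv _ iuP, der_inv _ ivP).
rewrite !(D21, D31, D32, D41, D42, D43).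
by ring: iuP ivP.
Qed.

Lemma dcurv2E : m ^+ 2 * dcurv2 a coefal coefbe r1 r2 =
  - (iu ^+ 2 * iv * sysop_lin l Du Dv DU DV DDu DDU
  - (2%:R * iu ^+ 3 * iv * DU d2 + iu ^+ 2 * iv ^+ 2 * DV d1)
    * sysop l Du Dv DDu).
Proof.
rewrite /dcurv2 (dirder_A _ _ _ h3) (dirder_A _ _ _ h4) /dal /dbe.
rewrite /coefal /coefbe /sysop /sysop_lin /DU /DV /DDU /U /V la3 la4 /Du /Dv /DDu /m.
rewrite !(derN, derB, DM, DD, Da, der1, der0).
rewrite !(der_inv _ iuP, der_inv _ ivP).
rewrite !(derN, derB, DM, DD, Da, der1, der0).
rewrite !(der_inv _ iuP, der_inv _ ivP).
rewrite !(D21, D31, D32, D41, D42, D43).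
by ring: iuP ivP.
Qed.

(** When u and v satisfy the system, E(R) = 0 if and only if the characteristic U = u_2 r2,
    V = - v_1 r1 satisfies the linearized equations. *)
Lemma symop_linearization :
  (symop l coefal coefbe (vert r1 r2) =1 fun=> 0) <->
  sysop_lin l Du Dv DU DV DDu DDU = 0 /\ sysop_lin l Du Dv DU DV DDv DDV = 0.
Proof.
have E : symop l coefal coefbe (vert r1 r2) =1
    vert (m * dcurv1 a coefal coefbe r1 r2) (m * dcurv2 a coefal coefbe r1 r2).
  move=> k; rewrite (symop_vert Dl Da la3 la4 _ _ DC) curv1_eq0 curv2_eq0.
  by rewrite !der0 /vert /m; case: eqP => _; [ring|case: eqP => _ //; ring].
have cniu x : iu * x = 0 -> x = 0.
  by move=> h; rewrite -[x]mul1r -iuP mulrAC h mul0r.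
have cniv x : iv * x = 0 -> x = 0.
  by move=> h; rewrite -[x]mul1r -ivP mulrAC h mul0r.
have := dcurv1E; rewrite eqv mulr0 subr0 => e1.
have := dcurv2E; rewrite equ mulr0 subr0 => e2.
split=> [h|[lu lv] k].
  have := h d2; rewrite E /vert /= => /(congr1 ( *%R m)).
  rewrite mulr0 mulrA -expr2 e2 => h2.
  have := h d1; rewrite E /vert /= => /(congr1 ( *%R m)).
  rewrite mulr0 mulrA -expr2 e1 => h1; split.
    apply: cniv; do 2 apply: (cniu).
    by rewrite -[RHS]oppr0 -[in RHS]h2; ring.
  by apply: cniu; do 2 apply: (cniv); rewrite -h1; ring.
rewrite E; have -> : dcurv1 a coefal coefbe r1 r2 = 0.
  by do 2 apply: cancelm; rewrite mulrA -expr2 e1 lv mulr0.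
have -> : dcurv2 a coefal coefbe r1 r2 = 0.
  by do 2 apply: cancelm; rewrite mulrA -expr2 e2 lu mulr0 oppr0.
by rewrite mulr0 /vert; do 2 case: eqP => // _.
Qed.
End Linearization.
End System.

(** * Compatibility of the relations for zeta *)
Section Prolongation.
Variables (l al be : 'I_4 -> Q) (Z : bool -> nat -> nat -> Q) (r : 'I_4 -> Q).
Let commZ i j := forall b m n, D i (D j (Z b m n)) = D j (D i (Z b m n)).
Let S : 'I_4 -> Q := vert (Z false 0 0) (Z true 0 0).
Let h3 : d3 = d4 \/ d3 = d3 := or_intror erefl.
Let h4 : d4 = d4 \/ d4 = d3 := or_introl erefl.

Hypotheses (cal : forall k, commute_on D (al k))
           (cbe : forall k, commute_on D (be k)).
Hypotheses (c1 : curv1 al be = 0) (c2 : curv2 al be = 0).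
Hypothesis transport : forall k, k = d4 \/ k = d3 ->
  lie (fieldA al be k) S =1 lie (fieldB l al be k) r.
Hypothesis symop_r : symop l al be r =1 fun=> 0.
Hypothesis DZ1 : forall b m n, D d1 (Z b m n) = Z b m.+1 n.
Hypothesis DZ2 : forall b m n, D d2 (Z b m n) = Z b m n.+1.
Hypothesis DZk : forall b m n k, k = d4 \/ k = d3 ->
  D k (Z b m n) = iter m (D d1) (iter n (D d2) (D k (Z b 0 0))).
Hypothesis commD : forall i j, commZ i j -> forall t, D i (D j t) = D j (D i t).

Lemma commZ_sym i j : commZ i j -> commZ j i.
Proof. by move=> h b m n; rewrite h. Qed.

(* The derivations commute on all Z b m n except possibly D d3 with D d4;    *)
(* that pair is settled on Z b 0 0 by the vanishing of E on r, and carried   *)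
(* over to Z b m n by the prolongation formulas.                             *)
Lemma commZ12 : commZ d1 d2.
Proof. by move=> b m n; rewrite DZ2 !DZ1 DZ2. Qed.

Lemma commZ1k k : k = d4 \/ k = d3 -> commZ d1 k.
Proof. by move=> hk b m n; rewrite DZ1 (DZk b m n hk) (DZk b m.+1 n hk). Qed.

Lemma iter_comm i j m t : (forall s, D i (D j s) = D j (D i s)) ->
  D i (iter m (D j) t) = iter m (D j) (D i t).
Proof. by move=> h; elim: m => [//|m IH]; rewrite !iterS h IH. Qed.

Lemma commZ2k k : k = d4 \/ k = d3 -> commZ d2 k.
Proof.
move=> hk b m n; rewrite DZ2 (DZk b m n hk) (DZk b m n.+1 hk).
exact: (iter_comm m _ (commD (commZ_sym commZ12))).
Qed.

Lemma commZ_but34 i j : (i, j) <> (d3, d4) -> (i, j) <> (d4, d3) -> commZ i j.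
Proof.
case: (ord4P i) => ->; case: (ord4P j) => -> n1 n2 //;
  first [ exact: commZ12 | exact: (commZ_sym commZ12)
        | exact: (commZ1k h3) | exact: (commZ1k h4)
        | exact: (commZ_sym (commZ1k h3)) | exact: (commZ_sym (commZ1k h4))
        | exact: (commZ2k h3) | exact: (commZ2k h4)
        | exact: (commZ_sym (commZ2k h3)) | exact: (commZ_sym (commZ2k h4)) ].
Qed.

Lemma commZ34 : commZ d3 d4.
Proof.
have c0 b : D d3 (D d4 (Z b 0 0)) = D d4 (D d3 (Z b 0 0)).
  have eS : S (if b then d2 else d1) = Z b 0 0 by case: b.
  apply/eqP; rewrite -subr_eq0 -eS (obstruction cal cbe c1 c2).
    rewrite (eq_lie (fun=> erefl) (transport h4)).
    by rewrite (eq_lie (fun=> erefl) (transport h3)); apply/eqP; exact: symop_r.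
  by move=> i j n1 n2; rewrite eS; exact: commZ_but34.
have ci k (hk : k = d4 \/ k = d3) m n t :
    D k (iter m (D d1) (iter n (D d2) t)) = iter m (D d1) (iter n (D d2) (D k t)).
  rewrite (iter_comm m _ (commD (commZ_sym (commZ1k hk)))).
  by rewrite (iter_comm n _ (commD (commZ_sym (commZ2k hk)))).
by move=> b m n; rewrite (DZk b m n h4) (DZk b m n h3) (ci _ h3) (ci _ h4) c0.
Qed.

(** Z b m n stands for the derivative of order (m, n) in (x1, x2) of zeta^1
    (b = false) or zeta^2 (b = true); the derivations commute on all of them. *)
Lemma prolongation_commute i j b m n :
  D i (D j (Z b m n)) = D j (D i (Z b m n)).
Proof.
have [/eqP [-> ->]|n1] := boolP ((i, j) == (d3, d4)); first exact: commZ34.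
have [/eqP [-> ->]|n2] := boolP ((i, j) == (d4, d3)); first by rewrite commZ34.
by apply: commZ_but34; apply/eqP.
Qed.
End Prolongation.

Lemma mulr_cancel_inv (i w x : Q) : i * w = 1 -> w * (x * i) = x.
Proof. by move=> h; rewrite mulrCA [w * i]mulrC h mulr1. Qed.

(** A component of [A_k, S] = Y, solved for the derivative t in x^k of the
    corresponding coefficient of S. *)
Lemma solve_transport (x y t t1 t2 z1 z2 p q w : Q) :
  t = - x * t1 + - y * t2 - (z1 * - p + z2 * - q) - (- w) ->
  x * t1 + y * t2 + 1 * t - (z1 * p + z2 * q) = w.
Proof. by move=> ->; ring. Qed.

End DiffAlgebra.

(** * Smooth functions on the jet space *)

Section JetTopology.
Variables (R : realType) (N : choiceType).
Local Notation pt := (jetpoint R N).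
Implicit Types (p q : pt) (c d : jetcoord N) (f g : pt -> R) (Om : set pt).

Lemma cvg_jetpoint (T : Type) (F : set_system T) (h : T -> pt) p :
  Filter F -> (forall c, h x c @[x --> F] --> p c) -> h x @[x --> F] --> p.
Proof.
move=> FF hc; have hF : Filter (h x @[x --> F]) by exact: fmap_filter.
by apply/(@pointwise_cvgP (discrete_topology (jetcoord N)) R _ p hF).
Qed.

Lemma jetcoord_continuous c : continuous (fun p : pt => p c).
Proof. exact: (@proj_continuous _ (fun=> R) c). Qed.

Lemma upd_id p c : upd p c (p c) = p.
Proof. by apply/funext => d; rewrite /upd; case: eqP => // ->. Qed.

Lemma updK p c s t : upd (upd p c s) c t = upd p c t.
Proof. by apply/funext => d; rewrite /upd; case: eqP. Qed.

Lemma upd_at p c t : upd p c t c = t.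
Proof. by rewrite /upd eqxx. Qed.

Lemma updN p c d t : d != c -> upd p c t d = p d.
Proof. by rewrite /upd => /negbTE ->. Qed.

Lemma updC p c d s t : c != d -> upd (upd p c s) d t = upd (upd p d t) c s.
Proof.
move=> cd; apply/funext => e; rewrite /upd.
by have [->|//] := eqVneq e d; rewrite eq_sym (negbTE cd).
Qed.

Lemma upd2_continuous p c d :
  continuous (fun st : R * R => upd (upd p c st.1) d st.2).
Proof.
move=> st; apply: cvg_jetpoint => e; rewrite /upd.
case: (e == d); first exact: cvg_snd.
by case: (e == c); [exact: cvg_fst|exact: cvg_cst].
Qed.

Lemma upd_continuous p c : continuous (upd p c).
Proof.
move=> t; apply: cvg_jetpoint => e; rewrite /upd.
by case: (e == c); [exact: cvg_id|exact: cvg_cst].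
Qed.

Lemma near_upd Om p c : open Om -> Om p -> \forall t \near p c, Om (upd p c t).
Proof.
move=> oOm Omp; have := @upd_continuous p c (p c); apply.
by rewrite upd_id; exact: open_nbhs_nbhs.
Qed.

Lemma pd_ext Om f g c p : open Om -> (forall q, Om q -> f q = g q) -> Om p ->
  pd c f p = pd c g p.
Proof.
move=> oOm fg Omp; rewrite /pd !derive1E; apply: near_eq_derive.
by near=> t; apply: fg; near: t; exact: near_upd.
Unshelve. all: by end_near. Qed.

(** What smoothness asks of a function and of each of its iterated derivatives:
    continuity, and existence of the partial derivatives, on Om. *)
Definition diffable Om f := forall p, Om p ->
  {for p, continuous f} /\
  forall c, derivable (fun t : R => f (upd p c t)) (p c) 1.

Lemma is_derive_pd Om f p c : diffable Om f -> Om p ->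
  is_derive (p c) 1 (fun t : R => f (upd p c t)) (pd c f p).
Proof.
by move=> df Omp; rewrite /pd derive1E; apply: derivableP; case: (df p Omp).
Qed.

Lemma pd_is_derive f p c (a : R) :
  is_derive (p c) 1 (fun t : R => f (upd p c t)) a -> pd c f p = a.
Proof. by move=> h; rewrite /pd derive1E derive_val. Qed.

Lemma diffable_ext Om f g : open Om -> (forall p, Om p -> f p = g p) ->
  diffable Om f -> diffable Om g.
Proof.
move=> oOm fg df p Omp; have [cf dfc] := df p Omp; split.
  suff : g x @[x --> p] --> f p by rewrite fg.
  have e : \forall q \near p, f q = g q.
    by apply: filterS (open_nbhs_nbhs (conj oOm Omp)) => q; exact: fg.
  move=> V fV; have h : nbhs p (f @^-1` V) := cf V fV.
  by apply: filterS2 e h => q /= ->.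
move=> c; apply: near_eq_derivable (dfc c).
by near=> t; apply: fg; near: t; exact: near_upd.
Unshelve. all: by end_near. Qed.

Lemma smooth_finite_dep Om f : smooth Om f -> finite_dep Om f.
Proof. by case. Qed.

Lemma smooth_diffable Om f : smooth Om f -> diffable Om f.
Proof. by move=> [_ /(_ [::])]. Qed.

(** A class of differentiable functions of finitely many coordinates that is
    closed under partial differentiation on Om consists of smooth functions. *)
Lemma smooth_coind Om (P : (pt -> R) -> Prop) f : open Om ->
  (forall g, P g -> [/\ finite_dep Om g, diffable Om g &
     forall c, exists2 h, P h & forall p, Om p -> pd c g p = h p]) ->
  P f -> smooth Om f.
Proof.
move=> oOm HP Pf; split; first by have [] := HP f Pf.
have key cs : exists2 g, P g & forall p, Om p -> iter_pd cs f p = g p.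
  elim: cs => [|c cs [g Pg eg]]; first by exists f.
  have [_ _ /(_ c) [h Ph eh]] := HP g Pg; exists h => // p Omp /=.
  by rewrite (pd_ext _ oOm eg Omp) eh.
move=> cs; have [g Pg eg] := key cs; have [_ dg _] := HP g Pg.
by apply: (diffable_ext oOm _ dg) => p Omp; rewrite eg.
Qed.

Lemma smooth_ext Om f g : open Om -> (forall p, Om p -> f p = g p) ->
  smooth Om f -> smooth Om g.
Proof.
move=> oOm fg [[s hs] df]; split.
  by exists s => p q Op Oq pq; rewrite -!fg//; exact: hs.
have e cs p : Om p -> iter_pd cs f p = iter_pd cs g p.
  by elim: cs p => [|c cs IH] p Omp /=; [exact: fg|exact: (pd_ext _ oOm IH Omp)].
by move=> cs; exact: diffable_ext oOm (e cs) (df cs).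
Qed.

(** On Om, the value of f is determined by the coordinates listed in s. *)
Definition depends_on Om f (s : seq (jetcoord N)) := forall p q, Om p -> Om q ->
  (forall c, c \in s -> p c = q c) -> f p = f q.

Lemma depends_onW Om f s s' : {subset s <= s'} ->
  depends_on Om f s -> depends_on Om f s'.
Proof. by move=> ss' h p q Op Oq pq; apply: h => // c /ss'; exact: pq. Qed.

Lemma pd_notin Om f s c p : open Om -> depends_on Om f s -> c \notin s ->
  Om p -> pd c f p = 0.
Proof.
move=> oOm hs cs Omp; apply: pd_is_derive.
apply: (@near_eq_is_derive R R R (cst (f p)) _ (p c) 1 0).
near=> t; apply: hs => //; first by near: t; exact: near_upd.
by move=> d ds; rewrite updN//; apply: contraNneq cs => <-.
Unshelve. all: by end_near. Qed.

Lemma depends_on_pd Om f s c : open Om -> depends_on Om f s ->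
  depends_on Om (pd c f) s.
Proof.
move=> oOm hs p q Op Oq pq; have [cs|cs] := boolP (c \in s); last first.
  by rewrite !(pd_notin oOm hs cs).
rewrite /pd !derive1E (pq c cs); apply: near_eq_derive.
near=> t; apply: hs.
- by near: t; rewrite -(pq c cs); exact: near_upd.
- by near: t; exact: near_upd.
- by move=> d ds; rewrite /upd; case: ifP => // _; exact: (pq _ ds).
Unshelve. all: by end_near. Qed.

Lemma smooth_pd Om f c : open Om -> smooth Om f -> smooth Om (pd c f).
Proof.
move=> oOm [[s hs] df]; split; first by exists s; exact: depends_on_pd.
by move=> cs; have := df (rcons cs c); rewrite /iter_pd foldr_rcons.
Qed.

Lemma smooth_coord_or_cst Om f : open Om ->
  (exists c, f = fun p => p c) \/ (exists k, f = fun=> k) -> smooth Om f.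
Proof.
move=> oOm.
apply: (@smooth_coind _ (fun f => (exists c, f = fun p => p c) \/
  (exists k, f = fun=> k))) => // {}f [[c ->]|[k ->]]; split.
- by exists [:: c] => p q _ _; apply; rewrite inE.
- move=> p Omp; split; first exact: jetcoord_continuous.
  move=> d; rewrite /upd; have [_|_] := eqVneq c d.
    exact: derivable_id.
  exact: derivable_cst.
- move=> d; exists (fun=> (c == d)%:R); first by right; exists (c == d)%:R.
  move=> p Omp; apply: pd_is_derive; rewrite /upd.
  by have [_|_] := eqVneq c d; [exact: is_derive_id|exact: is_derive_cst].
- by exists [::].
- by move=> p Omp; split; [exact: cst_continuous|move=> d; exact: derivable_cst].
- move=> d; exists (fun=> 0); first by right; exists 0.
  by move=> p Omp; apply: pd_is_derive; exact: is_derive_cst.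
Qed.

Lemma smooth_coord Om c : open Om -> smooth Om (fun p : pt => p c).
Proof. by move=> oOm; apply: smooth_coord_or_cst => //; left; exists c. Qed.

Lemma smooth_cst Om (k : R) : open Om -> smooth Om (fun _ : pt => k).
Proof. by move=> oOm; apply: smooth_coord_or_cst => //; right; exists k. Qed.

Lemma pd_coord c d p : pd d (fun p : pt => p c) p = (c == d)%:R.
Proof.
apply: pd_is_derive; rewrite /upd.
by have [_|_] := eqVneq c d; [exact: is_derive_id|exact: is_derive_cst].
Qed.

Lemma pd_cst d (k : R) p : pd d (fun _ : pt => k) p = 0.
Proof. by apply: pd_is_derive; exact: is_derive_cst. Qed.

Lemma pdD Om f g c p : diffable Om f -> diffable Om g -> Om p ->
  pd c (fun q => f q + g q) p = pd c f p + pd c g p.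
Proof.
move=> df dg Omp; apply: pd_is_derive.
exact: is_deriveD (is_derive_pd c df Omp) (is_derive_pd c dg Omp).
Qed.

Lemma pdM Om f g c p : diffable Om f -> diffable Om g -> Om p ->
  pd c (fun q => f q * g q) p = pd c f p * g p + f p * pd c g p.
Proof.
move=> df dg Omp; apply: pd_is_derive.
have := is_deriveM (is_derive_pd c df Omp) (is_derive_pd c dg Omp).
by rewrite upd_id addrC; congr is_derive; rewrite /GRing.scale/= mulrC.
Qed.

Lemma pdV Om f c p : diffable Om f -> Om p -> f p != 0 ->
  pd c (fun q => (f q)^-1) p = - ((f p)^-1 * (f p)^-1 * pd c f p).
Proof.
move=> df Omp fp0; apply: pd_is_derive.
have := @is_deriveV _ (fun t => f (upd p c t)) (p c) _ 1 _ (is_derive_pd c df Omp).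
rewrite upd_id => /(_ fp0); congr is_derive.
by rewrite /GRing.scale/= mulNr -exprVn expr2.
Qed.

(** The functions obtained from smooth ones by sums, products and inverses; this
    class is closed under partial differentiation. *)
Inductive smooth_alg Om : (pt -> R) -> Prop :=
| smooth_alg_base f : smooth Om f -> smooth_alg Om f
| smooth_algD f g : smooth_alg Om f -> smooth_alg Om g ->
    smooth_alg Om (fun p => f p + g p)
| smooth_algM f g : smooth_alg Om f -> smooth_alg Om g ->
    smooth_alg Om (fun p => f p * g p)
| smooth_algV f : (forall p, Om p -> f p != 0) -> smooth_alg Om f ->
    smooth_alg Om (fun p => (f p)^-1).

Lemma smooth_algP Om f : open Om -> smooth_alg Om f -> smooth Om f.
Proof.
move=> oOm; apply: (@smooth_coind _ (smooth_alg Om)) => // {}f; elim=> {f}.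
- move=> f sf; split; [exact: smooth_finite_dep|exact: smooth_diffable|].
  by move=> c; exists (pd c f) => //; apply: smooth_alg_base; exact: smooth_pd.
- move=> f g sf [[s hs] df pf] sg [[s' hs'] dg pg]; split.
  + exists (s ++ s') => p q Op Oq pq; congr (_ + _).
      by apply: hs => // c cs; apply: pq; rewrite mem_cat cs.
    by apply: hs' => // c cs; apply: pq; rewrite mem_cat cs orbT.
  + move=> p Op; have [cf dfp] := df p Op; have [cg dgp] := dg p Op.
    split; first exact: (@continuousD R R pt f g p cf cg).
    by move=> c; exact: derivableD.
  + move=> c; have [f' sf' ef] := pf c; have [g' sg' eg] := pg c.
    exists (fun p => f' p + g' p); first exact: smooth_algD.
    by move=> p Op; rewrite (pdD _ df dg)// ef// eg.
- move=> f g sf [[s hs] df pf] sg [[s' hs'] dg pg]; split.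
  + exists (s ++ s') => p q Op Oq pq; congr (_ * _).
      by apply: hs => // c cs; apply: pq; rewrite mem_cat cs.
    by apply: hs' => // c cs; apply: pq; rewrite mem_cat cs orbT.
  + move=> p Op; have [cf dfp] := df p Op; have [cg dgp] := dg p Op.
    split; first exact: (@continuousM R pt f g p cf cg).
    by move=> c; exact: derivableM.
  + move=> c; have [f' sf' ef] := pf c; have [g' sg' eg] := pg c.
    exists (fun p => f' p * g p + f p * g' p).
      by apply: smooth_algD; exact: smooth_algM.
    by move=> p Op; rewrite (pdM _ df dg)// ef// eg.
- move=> f f0 sf [[s hs] df pf]; split.
  + by exists s => p q Op Oq pq; congr (_^-1); exact: hs.
  + move=> p Op; have [cf dfp] := df p Op.
    split; first by apply: continuousV => //; exact: f0.
    move=> c; apply: ex_derive; apply: is_deriveV; last exact: is_derive_pd Op.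
    by rewrite upd_id f0.
  + move=> c; have [f' sf' ef] := pf c.
    exists (fun p => (fun=> -1) p * ((fun p => (f p)^-1 * (f p)^-1) p * f' p)).
      apply: smooth_algM; first by apply: smooth_alg_base; exact: smooth_cst.
      by apply: smooth_algM => //; apply: smooth_algM; exact: smooth_algV.
    by move=> p Op; rewrite (pdV _ df)// ?f0// ef// mulN1r.
Qed.

Lemma smoothD Om f g : open Om -> smooth Om f -> smooth Om g ->
  smooth Om (fun p => f p + g p).
Proof.
move=> oOm sf sg; apply: smooth_algP => //.
by apply: smooth_algD; exact: smooth_alg_base.
Qed.

Lemma smoothM Om f g : open Om -> smooth Om f -> smooth Om g ->
  smooth Om (fun p => f p * g p).
Proof.
move=> oOm sf sg; apply: smooth_algP => //.
by apply: smooth_algM; exact: smooth_alg_base.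
Qed.

Lemma smoothV Om f : open Om -> (forall p, Om p -> f p != 0) -> smooth Om f ->
  smooth Om (fun p => (f p)^-1).
Proof.
move=> oOm f0 sf; apply: smooth_algP => //.
by apply: smooth_algV => //; exact: smooth_alg_base.
Qed.

Lemma smoothN Om f : open Om -> smooth Om f -> smooth Om (fun p => - f p).
Proof.
move=> oOm sf; apply: (smooth_ext oOm _ (smoothM oOm (smooth_cst (-1) oOm) sf)).
by move=> p _; rewrite mulN1r.
Qed.

Lemma smoothB Om f g : open Om -> smooth Om f -> smooth Om g ->
  smooth Om (fun p => f p - g p).
Proof. by move=> oOm sf sg; exact: smoothD oOm sf (smoothN oOm sg). Qed.

Lemma smooth_sum Om (I : Type) (r : seq I) (F : I -> pt -> R) : open Om ->
  (forall i, smooth Om (F i)) -> smooth Om (fun p => \sum_(i <- r) F i p).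
Proof.
move=> oOm sF; elim: r => [|i r IH].
  by apply: (smooth_ext oOm _ (smooth_cst 0 oOm)) => p _; rewrite big_nil.
apply: (smooth_ext oOm _ (smoothD oOm (sF i) IH)) => p _.
by rewrite big_cons.
Qed.

End JetTopology.

(** * Symmetry of second partial derivatives *)

Section JetSchwarz.
Variables (R : realType) (N : choiceType).
Local Notation pt := (jetpoint R N).
Implicit Types (p q : pt) (c d : jetcoord N) (f g : pt -> R) (Om : set pt).

Lemma mean_value (g dg : R -> R) (a b : R) : a < b ->
  (forall x, x \in `[a, b] -> is_derive x 1 g (dg x)) ->
  exists2 x, x \in `]a, b[ & g b - g a = dg x * (b - a).
Proof.
move=> ab h; have h' x : x \in `]a, b[ -> is_derive x 1 g (dg x).
  by move=> xab; exact: (h x (subset_itv_oo_cc xab)).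
apply: (@MVT R g dg a b ab h').
apply: derivable_within_continuous => x xab.
by have [] := h x xab.
Qed.

Section MixedPartials.
Variables (Om : set pt) (f : pt -> R) (p : pt).
Hypotheses (oOm : open Om) (sf : smooth Om f) (Omp : Om p).

(** The second difference of f over a square of side h is h ^ 2 times a mixed
    second derivative at some point of the square. *)
Lemma second_difference c d (h : R) : c != d -> 0 < h ->
  (forall s t, s \in `[p c, p c + h] -> t \in `[p d, p d + h] ->
     Om (upd (upd p c s) d t)) ->
  exists s t, [/\ s \in `[p c, p c + h], t \in `[p d, p d + h] &
    f (upd (upd p c (p c + h)) d (p d + h)) - f (upd p c (p c + h))
    - (f (upd p d (p d + h)) - f p) =
    pd d (pd c f) (upd (upd p c s) d t) * h * h].
Proof.
move=> cd h0 hOm; set a := p c; set b := p d.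
have inl (x : R) : x \in `[x, x + h] by rewrite in_itv /= lexx lerDl ltW.
have inr (x : R) : x + h \in `[x, x + h] by rewrite in_itv /= lexx lerDl ltW.
have dg g s t : smooth Om g -> s \in `[a, a + h] -> t \in `[b, b + h] ->
    is_derive s 1 (fun s' => g (upd (upd p c s') d t))
                  (pd c g (upd (upd p c s) d t)).
  move=> sg sI tI; have O := hOm _ _ sI tI.
  have := is_derive_pd c (smooth_diffable sg) O.
  rewrite updN// upd_at; congr (is_derive _ _ _ _).
  by apply/funext => s'; rewrite -updC// updK.
have dg' g s t : smooth Om g -> s \in `[a, a + h] -> t \in `[b, b + h] ->
    is_derive t 1 (fun t' => g (upd (upd p c s) d t'))
                  (pd d g (upd (upd p c s) d t)).
  move=> sg sI tI; have O := hOm _ _ sI tI.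
  have := is_derive_pd d (smooth_diffable sg) O.
  rewrite upd_at; congr (is_derive _ _ _ _).
  by apply/funext => s'; rewrite updK.
have [s sI] := @mean_value
    (fun s => f (upd (upd p c s) d (b + h)) - f (upd (upd p c s) d b)) _ a (a + h)
    ltac:(by rewrite ltrDl)
    (fun s sI => is_deriveB (dg f s _ sf sI (inr b)) (dg f s _ sf sI (inl b))).
have [t tI et] := @mean_value _ _ b (b + h) ltac:(by rewrite ltrDl)
    (fun t tI => dg' _ s t (smooth_pd c oOm sf) (subset_itv_oo_cc sI) tI).
have eh x : x + h - x = h :> R by rewrite addrAC subrr add0r.
rewrite /= et !eh => e; exists s, t.
split; try exact: subset_itv_oo_cc.
have E s' : upd (upd p c s') d b = upd p c s'.
  by rewrite -[RHS](upd_id _ d) updN// eq_sym.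
by move: e; rewrite !E !upd_id.
Qed.

(** Both mixed derivatives are limits of the same second difference quotient. *)
Lemma pdC c d : pd c (pd d f) p = pd d (pd c f) p.
Proof.
have [->//|cd] := eqVneq c d.
apply/eqP; rewrite -subr_eq0 -normr_le0; apply/ler_addgt0Pr => e e0.
rewrite add0r.
have e20 : 0 < e / 2 by rewrite divr_gt0.
have cA := (smooth_diffable (smooth_pd c oOm (smooth_pd d oOm sf)) Omp).1.
have cB := (smooth_diffable (smooth_pd d oOm (smooth_pd c oOm sf)) Omp).1.
have near_p (V : set pt) : nbhs p V -> exists2 h : R, 0 < h & forall s t,
    s \in `[p c, p c + h] -> t \in `[p d, p d + h] ->
    V (upd (upd p c s) d t).
  move=> pV; have := @upd2_continuous R N p c d (p c, p d) V.
  rewrite /= !upd_id => /(_ pV) /nbhs_ballP[r /= r0 hr].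
  exists (r / 2); first by rewrite divr_gt0.
  move=> s t sI tI; apply: (hr (s, t)); split => /=.
    move: sI; rewrite in_itv /= /ball /= => /andP[s1 s2].
    by rewrite ler0_norm ?subr_le0// opprB; lra.
  move: tI; rewrite in_itv /= /ball /= => /andP[s1 s2].
  by rewrite ler0_norm ?subr_le0// opprB; lra.
pose V := Om `&` ([set q | `|pd c (pd d f) p - pd c (pd d f) q| < e / 2] `&`
                  [set q | `|pd d (pd c f) p - pd d (pd c f) q| < e / 2]).
have pV : nbhs p V.
  apply: filterI; first exact: open_nbhs_nbhs.
  by apply: filterI; [move/cvgrPdist_lt : cA => /(_ _ e20)
                     |move/cvgrPdist_lt : cB => /(_ _ e20)].
have [h h0 hV] := near_p V pV.
have [s [t [sI tI e1]]] := second_difference cd h0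
  (fun s t sI tI => (hV s t sI tI).1).
have hV' s' t' : s' \in `[p d, p d + h] -> t' \in `[p c, p c + h] ->
    V (upd (upd p d s') c t').
  by move=> sI' tI'; rewrite updC 1?eq_sym//; exact: hV.
have dc : d != c by rewrite eq_sym.
have [s' [t' [sI' tI' e2]]] := second_difference dc h0
  (fun s t sI tI => (hV' s t sI tI).1).
have [_ [_ B1]] := hV s t sI tI; have [_ [A1 _]] := hV' s' t' sI' tI'.
have e3 : pd d (pd c f) (upd (upd p c s) d t) =
          pd c (pd d f) (upd (upd p d s') c t').
  have hn0 : h != 0 by rewrite gt_eqF.
  apply: (mulIf hn0); apply: (mulIf hn0).
  apply: etrans (esym e1) _; apply: etrans _ e2; rewrite (updC _ _ _ cd).
  by rewrite !opprB addrACA [RHS]addrACA; congr (_ + _); exact: addrC.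
move: B1; rewrite /= e3 => B1.
have gen (x y z : R) : x - y = (x - z) - (y - z) by ring.
rewrite (gen _ _ (pd c (pd d f) (upd (upd p d s') c t'))).
apply: (le_trans (ler_normB _ _)); rewrite [leRHS]splitr.
by apply: ltW; exact: ltrD A1 B1.
Qed.

End MixedPartials.

End JetSchwarz.

(** * Total derivatives and the differential ideal of the system *)

(** The part of being a covering that makes total derivatives act on smooth
    functions; compatibility of the nonlocal relations is left out. *)
Definition regular (R : realType) (C : covering R) : Prop :=
  open (cdom C) /\ forall n i, smooth (cdom C) (nlrel C n i).

Lemma smooth_uj (R : realType) (N : choiceType) (Om : set (jetpoint R N)) s :
  open Om -> smooth Om (uj s).
Proof. by move=> oOm; exact: (smooth_coord (cu (mseq s)) oOm). Qed.

Lemma smooth_vj (R : realType) (N : choiceType) (Om : set (jetpoint R N)) s :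
  open Om -> smooth Om (vj s).
Proof. by move=> oOm; exact: (smooth_coord (cv (mseq s)) oOm). Qed.

Ltac smooth_step := first
  [ assumption
  | apply: smoothB | apply: smoothD | apply: smoothN | apply: smoothM
  | apply: smooth_uj | apply: smooth_vj | apply: smooth_coord
  | apply: smooth_cst ].

Section TotalDerivative.
Variables (R : realType) (lam : 'I_4 -> R) (C : covering R).
Hypothesis reg : regular C.
Local Notation pt := (jetpoint R (nlv C)).
Local Notation Om := (cdom C).
Implicit Types (f g : pt -> R) (p : pt) (c : jetcoord (nlv C)).

Let oOm : open Om. Proof. by case: reg. Qed.

Lemma smooth_Dcoord i c : smooth Om (Dcoord i c).
Proof.
case: c => [j|a|a|n].
- exact: (smooth_cst _ oOm).
- exact: (smooth_coord _ oOm).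
- exact: (smooth_coord _ oOm).
- exact: reg.2.
Qed.

Lemma DtotE i f s p : depends_on Om f s -> Om p ->
  Dtot i f p = \sum_(c <- undup s) Dcoord i c p * pd c f p.
Proof.
move=> hs Op; rewrite /Dtot [RHS]fsbig_seq ?undup_uniq//.
symmetry; apply: fsbig_widen => // c [_ /= cs].
rewrite (pd_notin oOm hs _ Op) ?mulr0//.
by apply/negP => h; apply: cs; rewrite mem_undup.
Qed.

Lemma Dtot_ext i f g p : (forall q, Om q -> f q = g q) -> Om p ->
  Dtot i f p = Dtot i g p.
Proof.
move=> fg Op; rewrite /Dtot; apply: eq_fsbigr => c _.
by rewrite (pd_ext c oOm fg Op).
Qed.

Lemma smooth_Dtot i f : smooth Om f -> smooth Om (Dtot i f).
Proof.
move=> sf; have [[s hs] _] := sf.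
apply: (smooth_ext oOm (f := fun p => \sum_(c <- undup s) Dcoord i c p * pd c f p)).
  by move=> p Op; rewrite (DtotE i hs Op).
apply: (smooth_sum _ oOm) => c.
exact: smoothM oOm (smooth_Dcoord i c) (smooth_pd c oOm sf).
Qed.

Lemma depends_on_cat f g : smooth Om f -> smooth Om g ->
  exists s, depends_on Om f s /\ depends_on Om g s.
Proof.
move=> [[s hs] _] [[s' hs'] _]; exists (s ++ s'); split.
  by apply: depends_onW hs => c; rewrite mem_cat => ->.
by apply: depends_onW hs' => c; rewrite mem_cat orbC => ->.
Qed.

Lemma DtotD i f g p : smooth Om f -> smooth Om g -> Om p ->
  Dtot i (fun q => f q + g q) p = Dtot i f p + Dtot i g p.
Proof.
move=> sf sg Op; have [s [hf hg]] := depends_on_cat sf sg.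
have hfg : depends_on Om (fun q => f q + g q) s.
  by move=> q q' Oq Oq' e; congr (_ + _); [exact: hf|exact: hg].
rewrite (DtotE i hf Op) (DtotE i hg Op) (DtotE i hfg Op) -big_split /=.
apply: eq_bigr => c _.
by rewrite (pdD c (smooth_diffable sf) (smooth_diffable sg) Op) mulrDr.
Qed.

Lemma DtotM i f g p : smooth Om f -> smooth Om g -> Om p ->
  Dtot i (fun q => f q * g q) p = Dtot i f p * g p + f p * Dtot i g p.
Proof.
move=> sf sg Op; have [s [hf hg]] := depends_on_cat sf sg.
have hfg : depends_on Om (fun q => f q * g q) s.
  by move=> q q' Oq Oq' e; congr (_ * _); [exact: hf|exact: hg].
rewrite (DtotE i hf Op) (DtotE i hg Op) (DtotE i hfg Op).
rewrite mulr_suml mulr_sumr -big_split /=; apply: eq_bigr => c _.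
rewrite (pdM c (smooth_diffable sf) (smooth_diffable sg) Op).
by rewrite mulrDr mulrA [in RHS](mulrCA (f p)).
Qed.

Lemma Dtot_cst i (k : R) p : Dtot i (fun=> k) p = 0.
Proof. by rewrite /Dtot fsbig1// => c _; rewrite pd_cst mulr0. Qed.

Lemma Dtot_coord i c p : Om p -> Dtot i (fun q => q c) p = Dcoord i c p.
Proof.
move=> Op; have h : depends_on Om (fun q => q c) [:: c].
  by move=> q q' _ _; apply; rewrite inE.
by rewrite (DtotE i h Op) /= big_seq1 pd_coord eqxx mulr1.
Qed.

Lemma Dtot_sum i (I : Type) (r : seq I) (F : I -> pt -> R) p :
  (forall k, smooth Om (F k)) -> Om p ->
  Dtot i (fun q => \sum_(k <- r) F k q) p = \sum_(k <- r) Dtot i (F k) p.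
Proof.
move=> sF Op; elim: r => [|k r IH].
  rewrite big_nil -[RHS](Dtot_cst i 0 p); apply: Dtot_ext Op => q _.
  by rewrite big_nil.
rewrite big_cons -IH -(DtotD i (sF k) (smooth_sum r oOm sF) Op).
by apply: Dtot_ext Op => q _; rewrite big_cons.
Qed.

(** The commutator of two total derivatives is the derivation given by their
    commutators on coordinates. *)
Lemma Dtot_comm i j f s p : smooth Om f -> depends_on Om f s -> Om p ->
  Dtot i (Dtot j f) p - Dtot j (Dtot i f) p =
  \sum_(c <- undup s) (Dtot i (Dcoord j c) p - Dtot j (Dcoord i c) p) * pd c f p.
Proof.
move=> sf hs Op.
have e k l : Dtot k (Dtot l f) p =
    \sum_(c <- undup s) Dtot k (Dcoord l c) p * pd c f p +
    \sum_(c <- undup s) \sum_(d <- undup s)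
       Dcoord l c p * (Dcoord k d p * pd d (pd c f) p).
  rewrite (Dtot_ext k (fun q => @DtotE l f s q hs) Op).
  have sF c : smooth Om (fun q => Dcoord l c q * pd c f q).
    exact: smoothM oOm (smooth_Dcoord l c) (smooth_pd c oOm sf).
  rewrite (Dtot_sum k _ sF Op) -big_split /=; apply: eq_bigr => c _.
  rewrite (DtotM k (smooth_Dcoord l c) (smooth_pd c oOm sf) Op).
  by rewrite (DtotE k (depends_on_pd c oOm hs) Op) mulr_sumr.
rewrite !e opprD addrACA [X in _ + (_ - X)]exchange_big /=.
rewrite -sumrB -[RHS]addr0; congr (_ + _).
  by apply: eq_bigr => c _; rewrite mulrBl.
apply/eqP; rewrite subr_eq0; apply/eqP.
apply: eq_bigr => c _; apply: eq_bigr => d _.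
by rewrite (pdC oOm sf Op d c) mulrCA.
Qed.

Lemma mshiftC a i j : mshift (mshift a i) j = mshift (mshift a j) i.
Proof. by apply/ffunP => k; rewrite !ffunE -!addnA (addnC (k == i)). Qed.

(** Every element of the differential ideal is smooth. *)
Lemma mod_sys_smooth f : mod_sys lam f -> smooth Om f.
Proof.
elim=> {f}.
- by rewrite /eval_sys /F1 /opS; repeat smooth_step.
- by rewrite /eval_sys /F2 /opS; repeat smooth_step.
- by move=> f g _ sf _ sg; exact: smoothD oOm sf sg.
- by move=> g f sg _ sf; exact: smoothM oOm sg sf.
- by move=> i f _ sf; exact: smooth_Dtot.
- by move=> f g fg _ sf; exact: smooth_ext oOm fg sf.
Qed.

Lemma mod_sys_eq0 f : (forall p, Om p -> f p = 0) -> mod_sys lam f.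
Proof.
move=> f0; apply: mod_ext (mod_mul (smooth_cst 0 oOm) (mod_F1 lam C)).
by move=> p Op; rewrite /= mul0r f0.
Qed.

Lemma mod_sysM f g : smooth Om f -> mod_sys lam g ->
  mod_sys lam (fun p => f p * g p).
Proof. exact: mod_mul. Qed.

Lemma mod_sysD f g : mod_sys lam f -> mod_sys lam g ->
  mod_sys lam (fun p => f p + g p).
Proof. exact: mod_add. Qed.

Lemma mod_sysN f : mod_sys lam f -> mod_sys lam (fun p => - f p).
Proof.
move=> mf; apply: mod_ext (mod_sysM (smooth_cst (-1) oOm) mf).
by move=> p _; rewrite mulN1r.
Qed.

Lemma mod_sys_sum (I : Type) (r : seq I) (F : I -> pt -> R) :
  (forall k, mod_sys lam (F k)) -> mod_sys lam (fun p => \sum_(k <- r) F k p).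
Proof.
move=> mF; elim: r => [|k r IH].
  by apply: mod_sys_eq0 => p _; rewrite big_nil.
by apply: mod_ext (mod_sysD (mF k) IH) => p _; rewrite big_cons.
Qed.

(** Total derivatives commute modulo the system on all smooth functions as
    soon as they do on the nonlocal variables. *)
Lemma mod_sys_comm i j f :
  (forall n, mod_sys lam (Dtot i (nlrel C n j) \- Dtot j (nlrel C n i))) ->
  smooth Om f ->
  mod_sys lam (fun p => Dtot i (Dtot j f) p - Dtot j (Dtot i f) p).
Proof.
move=> hn sf; have [[s hs] _] := sf.
pose F c p := pd c f p * (Dtot i (Dcoord j c) p - Dtot j (Dcoord i c) p).
apply: (@mod_ext _ _ _ (fun p => \sum_(c <- undup s) F c p)).
  move=> p Op; rewrite (Dtot_comm i j sf hs Op); apply: eq_bigr => c _.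
  by rewrite /F mulrC.
apply: mod_sys_sum => c; apply: mod_sysM; first exact: smooth_pd oOm sf.
case: c => [k|a|a|n]; last exact: hn.
- by apply: mod_sys_eq0 => p Op; rewrite !Dtot_cst subrr.
- by apply: mod_sys_eq0 => p Op; rewrite !Dtot_coord//= mshiftC subrr.
- by apply: mod_sys_eq0 => p Op; rewrite !Dtot_coord//= mshiftC subrr.
Qed.

End TotalDerivative.

(** * The quotient differential ring *)

(** Smooth functions on the domain of a covering. *)
Record smooth_fun (R : realType) (C : covering R) := SmoothFun {
  sval_fun :> jetpoint R (nlv C) -> R;
  smooth_funP : smooth (cdom C) sval_fun
}.

HB.instance Definition _ (R : realType) (C : covering R) :=
  gen_eqMixin (smooth_fun C).
HB.instance Definition _ (R : realType) (C : covering R) :=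
  gen_choiceMixin (smooth_fun C).

Section Quotient.
Local Open Scope quotient_scope.
Variables (R : realType) (lam : 'I_4 -> R) (C : covering R).
Variable reg : regular C.
Local Notation pt := (jetpoint R (nlv C)).
Local Notation Om := (cdom C).
Local Notation sf := (smooth_fun C).

Let oOm : open Om. Proof. by case: reg. Qed.

(** Congruence modulo the differential ideal of the system. *)
Definition sys_equiv (f g : sf) : bool := `[< mod_sys lam (fun p => f p - g p) >].

Lemma sys_equivP (f g : sf) :
  reflect (mod_sys lam (fun p => f p - g p)) (sys_equiv f g).
Proof. exact: asboolP. Qed.

Lemma sys_equiv_refl : reflexive sys_equiv.
Proof. by move=> f; apply/sys_equivP/(mod_sys_eq0 _ reg) => p _; rewrite subrr. Qed.

Lemma sys_equiv_sym : symmetric sys_equiv.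
Proof.
move=> f g; apply/idP/idP => /sys_equivP h; apply/sys_equivP;
  by apply: mod_ext (mod_sysN reg h) => p _; rewrite opprB.
Qed.

Lemma sys_equiv_trans : transitive sys_equiv.
Proof.
move=> g f h /sys_equivP fg /sys_equivP gh; apply/sys_equivP.
by apply: mod_ext (mod_sysD fg gh) => p _; rewrite subrKA.
Qed.

Canonical sys_equiv_rel :=
  EquivRel sys_equiv sys_equiv_refl sys_equiv_sym sys_equiv_trans.

(** The ring of smooth functions modulo the system.  It may be the zero ring, for
    instance when the domain is empty. *)
Definition jetring := {eq_quot sys_equiv}.
HB.instance Definition _ := Choice.on jetring.
HB.instance Definition _ := EqQuotient.on jetring.

Definition sf_add (f g : sf) :=
  SmoothFun (smoothD oOm (smooth_funP f) (smooth_funP g)).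
Definition sf_mul (f g : sf) :=
  SmoothFun (smoothM oOm (smooth_funP f) (smooth_funP g)).
Definition sf_opp (f : sf) := SmoothFun (smoothN oOm (smooth_funP f)).
Definition sf_cst (k : R) : sf := SmoothFun (smooth_cst k oOm).
Definition sf_D i (f : sf) : sf := SmoothFun (smooth_Dtot reg i (smooth_funP f)).

Lemma pi_eq (f g : sf) :
  \pi_jetring f = \pi_jetring g <-> mod_sys lam (fun p => f p - g p).
Proof.
by split=> [/eqmodP/sys_equivP //|h]; apply/eqmodP/sys_equivP.
Qed.

Lemma repr_equiv (f : sf) : mod_sys lam (fun p => f p - repr (\pi_jetring f) p).
Proof. by apply/pi_eq; rewrite reprK. Qed.

(** Operations induced on the quotient by those on functions. *)
Definition jadd (x y : jetring) := \pi_jetring (sf_add (repr x) (repr y)).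
Definition jmul (x y : jetring) := \pi_jetring (sf_mul (repr x) (repr y)).
Definition jopp (x : jetring) := \pi_jetring (sf_opp (repr x)).
Definition jcst (k : R) := \pi_jetring (sf_cst k).
Definition jD i (x : jetring) := \pi_jetring (sf_D i (repr x)).

Lemma pi_eq_on (f g : sf) : (forall p, Om p -> f p = g p) ->
  \pi_jetring f = \pi_jetring g.
Proof.
by move=> fg; apply/pi_eq/(mod_sys_eq0 _ reg) => p Op; rewrite fg// subrr.
Qed.

Lemma pi_jadd (f g : sf) : jadd (\pi_jetring f) (\pi_jetring g) = \pi_jetring (sf_add f g).
Proof.
apply/esym/pi_eq; apply: mod_ext (mod_sysD (repr_equiv f) (repr_equiv g)).
by move=> p _ /=; ring.
Qed.

Lemma pi_jmul (f g : sf) : jmul (\pi_jetring f) (\pi_jetring g) = \pi_jetring (sf_mul f g).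
Proof.
apply/esym/pi_eq; apply: mod_ext (mod_sysD
  (mod_sysM (smooth_funP g) (repr_equiv f))
  (mod_sysM (smooth_funP (repr (\pi_jetring f))) (repr_equiv g))).
by move=> p _ /=; ring.
Qed.

Lemma pi_jopp (f : sf) : jopp (\pi_jetring f) = \pi_jetring (sf_opp f).
Proof.
apply/esym/pi_eq; apply: mod_ext (mod_sysN reg (repr_equiv f)).
by move=> p _ /=; ring.
Qed.

Lemma pi_jD i (f : sf) : jD i (\pi_jetring f) = \pi_jetring (sf_D i f).
Proof.
apply/esym/pi_eq; set g := repr _.
have sg := smooth_funP g; have sF := smooth_funP f.
apply: mod_ext (mod_D i (repr_equiv f)) => p Op; rewrite /= -/g.
apply/eqP; rewrite eq_sym subr_eq; apply/eqP.
rewrite -(DtotD reg i (smoothB oOm sF sg) sg Op).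
by apply: (Dtot_ext reg i _ Op) => q _; rewrite subrK.
Qed.

Lemma jaddA : associative jadd.
Proof.
elim/quotW=> f; elim/quotW=> g; elim/quotW=> h.
rewrite (pi_jadd g h) (pi_jadd f g) !pi_jadd.
by apply: pi_eq_on => p _ /=; ring.
Qed.

Lemma jaddC : commutative jadd.
Proof.
elim/quotW=> f; elim/quotW=> g; rewrite !pi_jadd.
by apply: pi_eq_on => p _ /=; ring.
Qed.

Lemma jadd0 : left_id (jcst 0) jadd.
Proof.
elim/quotW=> f; rewrite (pi_jadd (sf_cst 0) f).
by apply: pi_eq_on => p _ /=; ring.
Qed.

Lemma jaddN : left_inverse (jcst 0) jopp jadd.
Proof.
elim/quotW=> f; rewrite (pi_jopp f) (pi_jadd (sf_opp f) f).
by apply: pi_eq_on => p _ /=; ring.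
Qed.

HB.instance Definition _ := GRing.isZmodule.Build jetring jaddA jaddC jadd0 jaddN.

Lemma jmulA : associative jmul.
Proof.
elim/quotW=> f; elim/quotW=> g; elim/quotW=> h.
rewrite (pi_jmul g h) (pi_jmul f g) !pi_jmul.
by apply: pi_eq_on => p _ /=; ring.
Qed.

Lemma jmulC : commutative jmul.
Proof.
elim/quotW=> f; elim/quotW=> g; rewrite !pi_jmul.
by apply: pi_eq_on => p _ /=; ring.
Qed.

Lemma jmul1 : left_id (jcst 1) jmul.
Proof.
elim/quotW=> f; rewrite (pi_jmul (sf_cst 1) f).
by apply: pi_eq_on => p _ /=; ring.
Qed.

Lemma jmulDl : left_distributive jmul jadd.
Proof.
elim/quotW=> f; elim/quotW=> g; elim/quotW=> h.
rewrite (pi_jadd f g) (pi_jmul f h) (pi_jmul g h) pi_jadd pi_jmul.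
by apply: pi_eq_on => p _ /=; ring.
Qed.

HB.instance Definition _ :=
  GRing.Zmodule_isComPzRing.Build jetring jmulA jmulC jmul1 jmulDl.

Lemma jD_add i (x y : jetring) : jD i (x + y) = jD i x + jD i y.
Proof.
elim/quotW: x => f; elim/quotW: y => g.
rewrite /GRing.add /= (pi_jadd f g) (pi_jD i f) (pi_jD i g) pi_jadd pi_jD.
by apply: pi_eq_on => p Op; exact: (DtotD reg i (smooth_funP f) (smooth_funP g) Op).
Qed.

Lemma jD_mul i (x y : jetring) : jD i (x * y) = jD i x * y + x * jD i y.
Proof.
elim/quotW: x => f; elim/quotW: y => g.
rewrite /GRing.add /GRing.mul /= (pi_jmul f g) (pi_jD i f) (pi_jD i g).
rewrite (pi_jmul f) (pi_jmul _ g) pi_jadd pi_jD.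
by apply: pi_eq_on => p Op; exact: (DtotM reg i (smooth_funP f) (smooth_funP g) Op).
Qed.

(** Class of a function in the quotient; functions that are not smooth are sent
    to 0, a default value. *)
Definition cls (f : pt -> R) : jetring :=
  if pselect (smooth Om f) is left sf then \pi_jetring (SmoothFun sf) else 0.

Lemma clsE f (sf : smooth Om f) : cls f = \pi_jetring (SmoothFun sf).
Proof. by rewrite /cls; case: pselect => // h; exact: pi_eq_on. Qed.

Lemma cls0P f : smooth Om f -> cls f = 0 <-> mod_sys lam f.
Proof.
move=> sF; rewrite (clsE sF) [0]/(jcst 0); rewrite pi_eq /=.
by split; apply: mod_ext => p _; rewrite subr0.
Qed.

Lemma cls_ext f g : smooth Om f -> (forall p, Om p -> f p = g p) -> cls f = cls g.
Proof.
move=> sF fg; rewrite (clsE sF) (clsE (smooth_ext oOm fg sF)).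
exact: pi_eq_on.
Qed.

Lemma clsD f g : smooth Om f -> smooth Om g ->
  cls (fun p => f p + g p) = cls f + cls g.
Proof.
move=> sF sG; rewrite (clsE sF) (clsE sG) (clsE (smoothD oOm sF sG)).
by rewrite [RHS]pi_jadd; exact: pi_eq_on.
Qed.

Lemma clsM f g : smooth Om f -> smooth Om g ->
  cls (fun p => f p * g p) = cls f * cls g.
Proof.
move=> sF sG; rewrite (clsE sF) (clsE sG) (clsE (smoothM oOm sF sG)).
by rewrite [RHS]pi_jmul; exact: pi_eq_on.
Qed.

Lemma clsN f : smooth Om f -> cls (fun p => - f p) = - cls f.
Proof.
move=> sF; rewrite (clsE sF) (clsE (smoothN oOm sF)).
by rewrite [RHS]pi_jopp; exact: pi_eq_on.
Qed.

Lemma clsB f g : smooth Om f -> smooth Om g ->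
  cls (fun p => f p - g p) = cls f - cls g.
Proof. by move=> sF sG; rewrite -(clsN sG) -(clsD sF (smoothN oOm sG)). Qed.

Lemma cls1 : cls (fun=> 1) = 1.
Proof. by rewrite (clsE (smooth_cst 1 oOm)); exact: pi_eq_on. Qed.

Lemma cls0 : cls (fun=> 0) = 0.
Proof. by rewrite (clsE (smooth_cst 0 oOm)); exact: pi_eq_on. Qed.

Lemma clsDtot i f : smooth Om f -> cls (Dtot i f) = jD i (cls f).
Proof.
move=> sF; rewrite (clsE sF) (clsE (smooth_Dtot reg i sF)) pi_jD.
exact: pi_eq_on.
Qed.

Lemma jD_cst i k : jD i (cls (fun=> k)) = 0.
Proof.
rewrite -(clsDtot i (smooth_cst k oOm)) -cls0.
apply: cls_ext; first exact: (smooth_Dtot reg i (smooth_cst k oOm)).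
by move=> p _; exact: Dtot_cst.
Qed.

Lemma cls_sum (I : Type) (r : seq I) (F : I -> pt -> R) :
  (forall k, smooth Om (F k)) ->
  cls (fun p => \sum_(k <- r) F k p) = \sum_(k <- r) cls (F k).
Proof.
move=> sF; elim: r => [|k r IH].
  rewrite big_nil -cls0; congr cls; apply/funext => p; exact: big_nil.
rewrite big_cons -IH -(clsD (sF k) (smooth_sum r oOm sF)).
by congr cls; apply/funext => p; rewrite big_cons.
Qed.

Lemma cls_comm i j f : smooth Om f ->
  (forall n, mod_sys lam (Dtot i (nlrel C n j) \- Dtot j (nlrel C n i))) ->
  jD i (jD j (cls f)) = jD j (jD i (cls f)).
Proof.
move=> sF h; have sD := fun k => smooth_Dtot reg k sF.
have sDD := fun k l => smooth_Dtot reg k (sD l).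
have e k l : jD k (jD l (cls f)) = cls (Dtot k (Dtot l f)).
  by rewrite (clsDtot k (sD l)) (clsDtot l sF).
rewrite (e i j) (e j i).
apply/eqP; rewrite -subr_eq0 -(clsB (sDD i j) (sDD j i)); apply/eqP.
by apply/(cls0P (smoothB oOm (sDD i j) (sDD j i))); exact: mod_sys_comm.
Qed.

End Quotient.

(** * Functions lifted to an extended covering *)

Section Lifting.
Variables (R : realType) (lam : 'I_4 -> R) (C : covering R) (M : choiceType).
Variables (Om : set (jetpoint R (nlv C + M)%type)).
Variables (W : M -> 'I_4 -> jetpoint R (nlv C + M)%type -> R).
Local Notation C' := (ext_cover Om W).
Local Notation fg := (@forget R C M).
Local Notation lift_c := (@lift_coord R C M).
Hypotheses (reg : regular C) (oOm : open Om).
Hypothesis domOm : forall q, Om q -> cdom C (fg q).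
Implicit Types (f : jetpoint R (nlv C) -> R) (q : jetpoint R (nlv C + M)%type).

Lemma lift_coord_inj : injective lift_c.
Proof. by move=> [i|a|a|n] [j|b|b|k] //= [->]. Qed.

Lemma coord_lift_or (c' : jetcoord (nlv C + M)%type) :
  (exists c, c' = lift_c c) \/ (exists m, c' = cw (inr m)).
Proof.
case: c' => [i|a|a|[n|m]].
- by left; exists (cx i).
- by left; exists (cu a).
- by left; exists (cv a).
- by left; exists (cw n).
- by right; exists m.
Qed.

Lemma forget_upd_lift q c t : fg (upd q (lift_c c) t) = upd (fg q) c t.
Proof.
by apply/funext => d; rewrite /forget /upd (inj_eq lift_coord_inj).
Qed.

Lemma forget_upd_new q m t : fg (upd q (cw (inr m)) t) = fg q.
Proof. by apply/funext => -[i|a|a|n]. Qed.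

Lemma forget_continuous : continuous fg.
Proof.
move=> q.
apply: (@cvg_jetpoint R (nlv C) _ (nbhs q) fg (fg q) (nbhs_filter q)) => c.
have h := @jetcoord_continuous R (nlv C + M)%type (lift_c c) q.
exact: h.
Qed.

Lemma pd_forget f c q : pd (lift_c c) (f \o fg) q = pd c f (fg q).
Proof.
rewrite /pd (_ : (fun t => (f \o fg) (upd q (lift_c c) t)) =
  (fun t => f (upd (fg q) c t)))//.
by apply/funext => t /=; rewrite forget_upd_lift.
Qed.

Lemma pd_forget_new f m q : pd (cw (inr m)) (f \o fg) q = 0.
Proof.
apply: pd_is_derive; rewrite (_ : (fun t => _) = cst (f (fg q))).
  exact: is_derive_cst.
by apply/funext => t /=; rewrite forget_upd_new.
Qed.

Lemma depends_on_forget f s : depends_on (cdom C) f s ->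
  depends_on Om (f \o fg) [seq lift_c c | c <- s].
Proof.
move=> hs p q Op Oq pq; apply: hs; [exact: domOm|exact: domOm|].
by move=> c cs; apply: pq; exact: map_f.
Qed.

Lemma smooth_forget f : smooth (cdom C) f -> smooth Om (f \o fg).
Proof.
move=> sf; apply: (@smooth_coind _ _ Om
  (fun g => exists2 f, smooth (cdom C) f & g = f \o fg)) => //; last by exists f.
move=> {sf f} _ [f sf ->]; split.
- by have [[s /depends_on_forget hs] _] := sf; exists [seq lift_c c | c <- s].
- move=> q Oq; have [cf df] := smooth_diffable sf (domOm Oq); split.
    apply: continuous_comp; first exact: forget_continuous.
    exact: cf.
  move=> c'; have [[c ->]|[m ->]] := coord_lift_or c'.
    have -> : (fun t => (f \o fg) (upd q (lift_c c) t)) =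
        (fun t => f (upd (fg q) c t)).
      by apply/funext => t /=; rewrite forget_upd_lift.
    exact: df.
  have -> : (fun t => (f \o fg) (upd q (cw (inr m)) t)) = cst (f (fg q)).
    by apply/funext => t /=; rewrite forget_upd_new.
  exact: derivable_cst.
- move=> c'; have [[c ->]|[m ->]] := coord_lift_or c'.
    exists (pd c f \o fg); last by move=> q _; exact: pd_forget.
    by exists (pd c f); [exact: smooth_pd reg.1 sf|].
  exists ((fun=> 0) \o fg); last by move=> q _; exact: pd_forget_new.
  by exists (fun=> 0); [exact: smooth_cst 0 reg.1|].
Qed.

Lemma regular_ext : (forall m i, smooth Om (W m i)) -> regular C'.
Proof.
move=> sW; split=> // -[n|m] i /=; last exact: sW.
exact: (smooth_forget (reg.2 n i)).
Qed.

Section Regular.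
Hypothesis reg' : regular C'.

Lemma Dcoord_lift i c q :
  @Dcoord R C' i (lift_c c) q = Dcoord i c (fg q).
Proof. by case: c. Qed.

Lemma Dtot_forget i f q : smooth (cdom C) f -> Om q ->
  @Dtot R C' i (f \o fg) q = Dtot i f (fg q).
Proof.
move=> [[s hs] _] Oq; have hs' := depends_on_forget hs.
rewrite (DtotE reg i hs (domOm Oq)) (@DtotE _ C' reg' i _ _ _ hs' Oq).
rewrite (undup_map_inj lift_coord_inj) big_map; apply: eq_bigr => c _.
by rewrite pd_forget Dcoord_lift.
Qed.

Lemma mod_sys_forget f : mod_sys lam f -> @mod_sys R lam C' (f \o fg).
Proof.
elim=> {f}.
- exact: mod_F1.
- exact: mod_F2.
- by move=> f g _ mf _ mg; exact: mod_add mf mg.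
- by move=> g f sg _ mf; exact: (@mod_mul _ _ C' _ _ (smooth_forget sg) mf).
- move=> i f mf mf'; have sf := mod_sys_smooth reg mf.
  by apply: mod_ext (mod_D i mf') => q Oq; exact: Dtot_forget.
- by move=> f g e _ mf; apply: mod_ext mf => q Oq; exact: e (domOm Oq).
Qed.
End Regular.
End Lifting.

(** * Classes of the expressions in the statement *)

Section Represents.
Variables (R : realType) (lam : 'I_4 -> R) (C : covering R) (reg : regular C).
Local Notation pt := (jetpoint R (nlv C)).
Local Notation Om := (cdom C).
Local Notation Q := (jetring lam reg).
Local Notation D := (@jD R lam C reg).

(** The function f is smooth and its class is x. *)
Definition rep (f : pt -> R) (x : Q) := smooth Om f /\ cls lam reg f = x.

Lemma rep_cls f : smooth Om f -> rep f (cls lam reg f).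
Proof. by []. Qed.

Lemma rep_ext f g x : (forall p, Om p -> f p = g p) -> rep f x -> rep g x.
Proof.
move=> fg [sf <-]; split; first exact: (smooth_ext reg.1 fg sf).
exact/esym/cls_ext.
Qed.

Lemma rep_eq f x y : rep f x -> x = y -> rep f y.
Proof. by move=> h <-. Qed.

Lemma rep_fun f x y : rep f x -> rep f y -> x = y.
Proof. by move=> [_ <-] [_ <-]. Qed.

Lemma repD f g x y : rep f x -> rep g y -> rep (fun p => f p + g p) (x + y).
Proof.
move=> [sf <-] [sg <-]; split; [exact: (smoothD reg.1 sf sg)|exact: clsD].
Qed.

Lemma repM f g x y : rep f x -> rep g y -> rep (fun p => f p * g p) (x * y).
Proof.
move=> [sf <-] [sg <-]; split; [exact: (smoothM reg.1 sf sg)|exact: clsM].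
Qed.

Lemma repN f x : rep f x -> rep (fun p => - f p) (- x).
Proof. by move=> [sf <-]; split; [exact: (smoothN reg.1 sf)|exact: clsN]. Qed.

Lemma repB f g x y : rep f x -> rep g y -> rep (fun p => f p - g p) (x - y).
Proof. by move=> hf hg; exact: repD hf (repN hg). Qed.

Lemma rep_sum (I : Type) (r : seq I) (F : I -> pt -> R) (X : I -> Q) :
  (forall k, rep (F k) (X k)) ->
  rep (fun p => \sum_(k <- r) F k p) (\sum_(k <- r) X k).
Proof.
move=> h; split; first by apply: (smooth_sum r reg.1) => k; exact: (h k).1.
rewrite cls_sum; last by move=> k; exact: (h k).1.
by apply: eq_bigr => k _; exact: (h k).2.
Qed.

Lemma rep_cst k : rep (fun=> k) (cls lam reg (fun=> k)).
Proof. exact: (rep_cls (smooth_cst k reg.1)). Qed.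

Lemma rep0 : rep (fun=> 0) 0.
Proof. by split; [exact: (smooth_cst 0 reg.1)|exact: cls0]. Qed.

Lemma rep1 : rep (fun=> 1) 1.
Proof. by split; [exact: (smooth_cst 1 reg.1)|exact: cls1]. Qed.

Lemma rep_Dtot i f x : rep f x -> rep (Dtot i f) (D i x).
Proof.
by move=> [sf <-]; split; [exact: (smooth_Dtot reg i sf)|exact: clsDtot].
Qed.

Lemma rep_coord c : rep (fun p => p c) (cls lam reg (fun p => p c)).
Proof. exact: (rep_cls (smooth_coord c reg.1)). Qed.

Lemma rep_mod_sys f x : rep f x -> mod_sys lam f <-> x = 0.
Proof. by move=> [sf <-]; split=> /cls0P; apply. Qed.

Lemma mseq_cons i s : mseq (i :: s) = mshift (mseq s) i.
Proof. by apply/ffunP => j; rewrite !ffunE /= addnC eq_sym. Qed.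

Lemma Dtot_uj i s p : Om p -> Dtot i (uj s) p = uj (i :: s) p.
Proof. by move=> Op; rewrite (Dtot_coord reg i _ Op) /uj mseq_cons. Qed.

Lemma Dtot_vj i s p : Om p -> Dtot i (vj s) p = vj (i :: s) p.
Proof. by move=> Op; rewrite (Dtot_coord reg i _ Op) /vj mseq_cons. Qed.

(** Classes of u and v. *)
Definition ucls : Q := cls lam reg (uj [::]).
Definition vcls : Q := cls lam reg (vj [::]).

Lemma rep_u1 i : rep (uj [:: i]) (D i ucls).
Proof.
apply: rep_ext (rep_Dtot i (rep_coord _)) => p Op; exact: Dtot_uj.
Qed.

Lemma rep_v1 i : rep (vj [:: i]) (D i vcls).
Proof.
apply: rep_ext (rep_Dtot i (rep_coord _)) => p Op; exact: Dtot_vj.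
Qed.

Lemma rep_u2 i j : rep (uj [:: i; j]) (D i (D j ucls)).
Proof. apply: rep_ext (rep_Dtot i (rep_u1 j)) => p Op; exact: Dtot_uj. Qed.

Lemma rep_v2 i j : rep (vj [:: i; j]) (D i (D j vcls)).
Proof. apply: rep_ext (rep_Dtot i (rep_v1 j)) => p Op; exact: Dtot_vj. Qed.

(** Classes of the constants l_j and (l2 - lk) / (l1 - l2). *)
Definition lamcls (j : 'I_4) : Q := cls lam reg (fun=> lam j).
Definition acls (k : 'I_4) : Q :=
  cls lam reg (fun=> (lam d2 - lam k) / (lam d1 - lam d2)).

Lemma rep_lam j : rep (fun=> lam j) (lamcls j).
Proof. exact: rep_cst. Qed.

(* The structure of the class dictates which closure lemma applies. *)
Ltac rep_poly := repeat match goal with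
  | |- rep _ (_ + _) => apply: repD
  | |- rep _ (- _) => apply: repN
  | |- rep _ (_ * _) => apply: repM
  | |- rep _ (lamcls _) => exact: rep_lam
  | |- rep _ (jD _ ucls) => exact: rep_u1
  | |- rep _ (jD _ vcls) => exact: rep_v1
  | |- rep _ (jD _ (jD _ ucls)) => exact: rep_u2
  | |- rep _ (jD _ (jD _ vcls)) => exact: rep_v2
  | |- rep _ (jD _ _) => apply: rep_Dtot
  | h : rep _ ?x |- rep _ ?x => exact: h
  end.

Lemma rep_F1 : rep (eval_sys (F1 lam))
  (sysop lamcls (fun i => D i ucls) (fun i => D i vcls)
     (fun i j => D i (D j ucls))).
Proof. rewrite /eval_sys /F1 /opS /sysop; rep_poly. Qed.

Lemma rep_F2 : rep (eval_sys (F2 lam))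
  (sysop lamcls (fun i => D i ucls) (fun i => D i vcls)
     (fun i j => D i (D j vcls))).
Proof. rewrite /eval_sys /F2 /opS /sysop; rep_poly. Qed.

Lemma eq_F1 : sysop lamcls (fun i => D i ucls) (fun i => D i vcls)
     (fun i j => D i (D j ucls)) = 0.
Proof. exact/(rep_mod_sys rep_F1)/mod_F1. Qed.

Lemma eq_F2 : sysop lamcls (fun i => D i ucls) (fun i => D i vcls)
     (fun i j => D i (D j vcls)) = 0.
Proof. exact/(rep_mod_sys rep_F2)/mod_F2. Qed.

Lemma derive1_cubic (a b c d : R) :
  derive1 (fun e : R => a + e * (b + e * (c + e * d))) 0 = b.
Proof.
have hc (k : R) : is_derive (0 : R) 1 (cst k) 0 by exact: is_derive_cst.
have hi : is_derive (0 : R) 1 id 1 by exact: is_derive_id.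
have h := is_deriveD (hc a) (is_deriveM hi
  (is_deriveD (hc b) (is_deriveM hi (is_deriveD (hc c) (is_deriveM hi (hc d)))))).
rewrite derive1E; apply: etrans (@derive_val _ _ _ _ _ _ _ h) _.
rewrite /GRing.scale /= !fctE. ring.
Qed.

Lemma derive1_opS (du dv eu ev : 'I_4 -> R) (h k : 'I_4 -> 'I_4 -> R) :
  derive1 (fun e : R => opS lam (fun i => du i + e * eu i)
     (fun i => dv i + e * ev i) (fun i j => h i j + e * k i j)) 0 =
  sysop_lin lam du dv eu ev h k.
Proof.
(* the coefficients of e ^ 2 and e ^ 3 are the values of the same
   multilinear expression on the increments *)
pose mixed := sysop lam du ev k + sysop lam eu dv k + sysop lam eu ev h.
have -> : (fun e : R => opS lam (fun i => du i + e * eu i)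
     (fun i => dv i + e * ev i) (fun i j => h i j + e * k i j)) =
  (fun e => sysop lam du dv h + e * (sysop_lin lam du dv eu ev h k
              + e * (mixed + e * sysop lam eu ev k))).
  by apply/funext => e; rewrite /mixed /opS /sysop /sysop_lin; ring.
exact: derive1_cubic.
Qed.

Lemma rep_linearize1 U V x y : rep U x -> rep V y ->
  rep (linearize (F1 lam) U V)
   (sysop_lin lamcls (fun i => D i ucls) (fun i => D i vcls)
      (fun i => D i x) (fun i => D i y)
      (fun i j => D i (D j ucls)) (fun i j => D i (D j x))).
Proof.
move=> hU hV.
apply: (@rep_ext (fun p => sysop_lin lam (fun i => uj [:: i] p)
   (fun i => vj [:: i] p) (fun i => Dtot i U p) (fun i => Dtot i V p)
   (fun i j => uj [:: i; j] p) (fun i j => Dtot i (Dtot j U) p))).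
  by move=> p _; rewrite /linearize /F1 derive1_opS.
rewrite /sysop_lin; rep_poly.
Qed.

Lemma rep_linearize2 U V x y : rep U x -> rep V y ->
  rep (linearize (F2 lam) U V)
   (sysop_lin lamcls (fun i => D i ucls) (fun i => D i vcls)
      (fun i => D i x) (fun i => D i y)
      (fun i j => D i (D j vcls)) (fun i j => D i (D j y))).
Proof.
move=> hU hV.
apply: (@rep_ext (fun p => sysop_lin lam (fun i => uj [:: i] p)
   (fun i => vj [:: i] p) (fun i => Dtot i U p) (fun i => Dtot i V p)
   (fun i j => vj [:: i; j] p) (fun i j => Dtot i (Dtot j V) p))).
  by move=> p _; rewrite /linearize /F2 derive1_opS.
rewrite /sysop_lin; rep_poly.
Qed.

Lemma rep_bracket (X Y : vfield C) (x y : 'I_4 -> Q) :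
  (forall i, rep (X i) (x i)) -> (forall i, rep (Y i) (y i)) ->
  forall k, rep (bracket X Y k) (lie D x y k).
Proof.
move=> hX hY k.
have -> : lie D x y k = \sum_(i < 4) (x i * D i (y k) - y i * D i (x k)).
  by rewrite /lie /dirder sumrB.
apply: rep_sum => i.
by apply: repB; apply: repM => //; exact: rep_Dtot.
Qed.

End Represents.

Section Dictionary.
Variables (R : realType) (lam : 'I_4 -> R) (hlam : injective lam).
Variables (C : covering R) (reg : regular C).
Hypothesis nondeg : forall p, cdom C p -> uj [:: d2] p * vj [:: d1] p != 0.
Local Notation pt := (jetpoint R (nlv C)).
Local Notation Om := (cdom C).
Local Notation Q := (jetring lam reg).
Local Notation D := (@jD R lam C reg).
Local Notation rp := (@rep R lam C reg).
Local Notation u := (ucls lam reg).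
Local Notation v := (vcls lam reg).
Local Notation L := (lamcls lam reg).
Local Notation A := (acls lam reg).

Let lam12 : lam d1 - lam d2 != 0.
Proof. by rewrite subr_eq0; apply/eqP => /hlam. Qed.

Let u2_neq0 p : Om p -> uj [:: d2] p != 0.
Proof. by move=> /nondeg; rewrite mulf_eq0 negb_or => /andP[]. Qed.

Let v1_neq0 p : Om p -> vj [:: d1] p != 0.
Proof. by move=> /nondeg; rewrite mulf_eq0 negb_or => /andP[]. Qed.

(** Classes of 1 / u_2, 1 / v_1 and 1 / (l1 - l2). *)
Definition iucls : Q := cls lam reg (fun p => (uj [:: d2] p)^-1).
Definition ivcls : Q := cls lam reg (fun p => (vj [:: d1] p)^-1).
Definition m_invcls : Q := cls lam reg (fun=> (lam d1 - lam d2)^-1).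

Lemma rep_iu : rp (fun p => (uj [:: d2] p)^-1) iucls.
Proof. by apply: rep_cls; apply: (smoothV reg.1 u2_neq0); exact: (rep_u1 _ _ _).1. Qed.

Lemma rep_iv : rp (fun p => (vj [:: d1] p)^-1) ivcls.
Proof. by apply: rep_cls; apply: (smoothV reg.1 v1_neq0); exact: (rep_v1 _ _ _).1. Qed.

Lemma iuclsP : iucls * D d2 u = 1.
Proof.
apply: rep_fun (repM rep_iu (rep_u1 _ _ _)) _.
by apply: rep_ext (rep1 _ _) => p Op; rewrite mulVf// u2_neq0.
Qed.

Lemma ivclsP : ivcls * D d1 v = 1.
Proof.
apply: rep_fun (repM rep_iv (rep_v1 _ _ _)) _.
by apply: rep_ext (rep1 _ _) => p Op; rewrite mulVf// v1_neq0.
Qed.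

Lemma m_invclsP : m_invcls * (L d1 - L d2) = 1.
Proof.
apply: rep_fun (repM (rep_cst _ _ _) (repB (rep_lam _ _ d1) (rep_lam _ _ d2))) _.
by apply: rep_ext (rep1 _ _) => p Op; rewrite mulVf.
Qed.

Lemma lamclsE k : L k = L d2 - (L d1 - L d2) * A k.
Proof.
apply: rep_fun (rep_lam _ _ k) _; apply: rep_ext; last first.
  exact: (repB (rep_lam _ _ d2) (repM (repB (rep_lam _ _ d1) (rep_lam _ _ d2))
    (rep_cst _ _ _))).
by move=> p _ /=; rewrite mulrC divfK// subKr.
Qed.

Lemma D_lamcls i j : D i (L j) = 0. Proof. exact: jD_cst. Qed.
Lemma D_acls i k : D i (A k) = 0. Proof. exact: jD_cst. Qed.

(** Classes of the coefficients al_k and be_k. *)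
Definition alcls := coefal D A v ivcls.
Definition becls := coefbe D A u iucls.

Lemma rep_al k : rp (fun p => (lam d2 - lam k) / (lam d1 - lam d2) *
  (vj [:: k] p / vj [:: d1] p)) (alcls k).
Proof.
exact: repM (rep_cst _ _ _) (repM (rep_v1 _ _ _) rep_iv).
Qed.

Lemma rep_be k : rp (fun p => - ((lam d1 - lam k) / (lam d1 - lam d2) *
  (uj [:: k] p / uj [:: d2] p))) (becls k).
Proof.
apply: rep_ext (repN (repM (repD (rep1 _ _) (rep_cst _ _
  ((lam d2 - lam k) / (lam d1 - lam d2)))) (repM (rep_u1 _ _ k) rep_iu))) => p _.
congr (- (_ * _)); apply: (mulIf lam12).
by rewrite mulrDl !divfK// mul1r addrA subrK.
Qed.

Lemma rep_Xlax1 k : k = d4 \/ k = d3 ->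
  forall i, rp (Xlax1 lam k i) (- fieldA alcls becls k i).
Proof.
move=> hk i; rewrite /fieldA /horiz.
have [-> /=|n1] := eqVneq i d1.
  apply: rep_ext (repN (rep_al k)) => p _; rewrite /Xlax1 /Xlax /=; ring.
have [-> /=|n2] := eqVneq i d2.
  apply: rep_ext (repN (rep_be k)) => p _; rewrite /Xlax1 /Xlax /=; ring.
have [->|n3] := eqVneq i k.
  apply: rep_ext (repN (rep1 _ _)) => p _; rewrite /Xlax1 /Xlax.
  by case: hk => -> /=; ring.
apply: rep_ext (repN (rep0 _ _)) => p _.
by rewrite /Xlax1 /Xlax (negbTE n1) (negbTE n2) (negbTE n3) subrr oppr0.
Qed.

Lemma rep_Xlax0 k : k = d4 \/ k = d3 ->
  forall i, rp (Xlax0 lam k i) (- fieldB L alcls becls k i).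
Proof.
move=> hk i; rewrite /fieldB /horiz.
have [-> /=|n1] := eqVneq i d1.
  apply: rep_ext (repN (repM (rep_lam _ _ d1) (rep_al k))) => p _.
  by rewrite /Xlax0 /Xlax /=; ring.
have [-> /=|n2] := eqVneq i d2.
  apply: rep_ext (repN (repM (rep_lam _ _ d2) (rep_be k))) => p _.
  by rewrite /Xlax0 /Xlax /=; ring.
have [->|n3] := eqVneq i k.
  apply: rep_ext (repN (rep_lam _ _ k)) => p _; rewrite /Xlax0 /Xlax.
  by case: hk => -> /=; ring.
apply: rep_ext (repN (rep0 _ _)) => p _.
by rewrite /Xlax0 /Xlax (negbTE n1) (negbTE n2) (negbTE n3) oppr0.
Qed.

Lemma rep_Rfield U V x y : rp U x -> rp V y ->
  forall i, rp (Rfield U V i) (vert (- (y * ivcls)) (x * iucls) i).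
Proof.
move=> hU hV i; rewrite /Rfield /vert.
have [_|_] := eqVneq i d1; first exact: repN (repM hV rep_iv).
have [_|_] := eqVneq i d2; first exact: repM hU rep_iu.
exact: rep0.
Qed.

Lemma rep_Sfield z1 z2 x y : rp z1 x -> rp z2 y ->
  forall i, rp (Sfield z1 z2 i) (vert x y i).
Proof.
move=> hU hV i; rewrite /Sfield /vert.
have [_|_] := eqVneq i d1; first exact: hU.
have [_|_] := eqVneq i d2; first exact: hV.
exact: rep0.
Qed.

Lemma rep_bracket1 k (Y : vfield C) y : k = d4 \/ k = d3 ->
  (forall i, rp (Y i) (y i)) ->
  forall j, rp (bracket (Xlax1 lam k) Y j) (- lie D (fieldA alcls becls k) y j).
Proof.
move=> hk hY j; apply: rep_eq (rep_bracket (rep_Xlax1 hk) hY j) _.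
exact: (lieN (@jD_add _ _ _ _)).
Qed.

Lemma rep_bracket0 k (Y : vfield C) y : k = d4 \/ k = d3 ->
  (forall i, rp (Y i) (y i)) ->
  forall j, rp (bracket (Xlax0 lam k) Y j) (- lie D (fieldB L alcls becls k) y j).
Proof.
move=> hk hY j; apply: rep_eq (rep_bracket (rep_Xlax0 hk) hY j) _.
exact: (lieN (@jD_add _ _ _ _)).
Qed.

Lemma commute_u : commute_on D u.
Proof.
move=> i j; apply: rep_fun (rep_u2 _ _ i j) _.
apply: rep_ext (rep_u2 _ _ j i) => p _.
by rewrite /uj !mseq_cons mshiftC.
Qed.

Lemma commute_v : commute_on D v.
Proof.
move=> i j; apply: rep_fun (rep_v2 _ _ i j) _.
apply: rep_ext (rep_v2 _ _ j i) => p _.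
by rewrite /vj !mseq_cons mshiftC.
Qed.

Let DD := @jD_add R lam C reg.
Let DM := @jD_mul R lam C reg.

Lemma curv1_cls : curv1 D alcls becls = 0.
Proof.
exact: (curv1_eq0 DM D_acls (lamclsE _) (lamclsE _) iuclsP ivclsP commute_v
  m_invclsP (eq_F2 _ _)).
Qed.

Lemma curv2_cls : curv2 D alcls becls = 0.
Proof.
exact: (curv2_eq0 DD DM D_acls (lamclsE _) (lamclsE _) iuclsP ivclsP commute_u
  m_invclsP (eq_F1 _ _)).
Qed.

Lemma curvB1_cls : curvB1 D L alcls becls = 0.
Proof.
exact: (curvB1_eq0 DM D_acls (lamclsE _) (lamclsE _) iuclsP ivclsP commute_v
  m_invclsP (eq_F2 _ _)).
Qed.

Lemma curvB2_cls : curvB2 D L alcls becls = 0.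
Proof.
exact: (curvB2_eq0 DD DM D_acls (lamclsE _) (lamclsE _) iuclsP ivclsP commute_u
  m_invclsP (eq_F1 _ _)).
Qed.

Lemma cls_surj (x : Q) : exists2 f, smooth Om f & cls lam reg f = x.
Proof.
exists (generic_quotient.repr x); first exact: smooth_funP.
rewrite (clsE _ _ (smooth_funP _)) -[RHS]generic_quotient.reprK.
exact: pi_eq_on.
Qed.

Lemma D_comm i j :
  (forall n, mod_sys lam (Dtot i (nlrel C n j) \- Dtot j (nlrel C n i))) ->
  forall x : Q, D i (D j x) = D j (D i x).
Proof. by move=> h x; have [f sf <-] := cls_surj x; exact: cls_comm. Qed.

(** Over a covering, a pair is a solution of the linearized system if and only if
    E vanishes on the corresponding vector field. *)
Lemma symop_linearize U V r1 r2 :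
  (forall i j n, mod_sys lam (Dtot i (nlrel C n j) \- Dtot j (nlrel C n i))) ->
  rp U (D d2 u * r2) -> rp V (- (D d1 v * r1)) ->
  (symop D L alcls becls (vert r1 r2) =1 fun=> 0) <->
  mod_sys lam (linearize (F1 lam) U V) /\ mod_sys lam (linearize (F2 lam) U V).
Proof.
move=> cC hU hV.
have DC (x : Q) : commute_on D x by move=> i j; exact: D_comm (cC i j) x.
apply: iff_trans (symop_linearization DD DM D_lamcls D_acls (lamclsE _) (lamclsE _)
  iuclsP ivclsP commute_u commute_v m_invclsP (eq_F2 _ _) (eq_F1 _ _) DC r1 r2) _.
have [a1 b1] := rep_mod_sys (rep_linearize1 hU hV).
have [a2 b2] := rep_mod_sys (rep_linearize2 hU hV).
by split=> -[e1 e2]; split; [exact: b1|exact: b2|exact: a1|exact: a2].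
Qed.

End Dictionary.

(** * The recursion operator *)

Lemma is_covering_regular (R : realType) (lam : 'I_4 -> R) (C : covering R) :
  is_covering lam C -> regular C.
Proof. by case=> oOm _ sW _; split. Qed.

(** Solutions of the relations for zeta give symmetries.  That (U, V) itself is a
    symmetry is needed only for solutions to exist. *)
Theorem new_symmetry (R : realType) (lam : 'I_4 -> R) (hlam : injective lam)
    (C : covering R) (U V z1 z2 : jetpoint R (nlv C) -> R) :
  is_covering lam C ->
  smooth (cdom C) U -> smooth (cdom C) V ->
  smooth (cdom C) z1 -> smooth (cdom C) z2 ->
  zeta_relations lam C U V z1 z2 ->
  nonlocal_symmetry lam C (fun q => uj [:: d2] q * z2 q)
    (fun q => - (vj [:: d1] q * z1 q)).
Proof.
move=> covC sU sV s1 s2 zeta; have reg := is_covering_regular covC.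
have [oOm nondeg _ cC] := covC.
have hU := rep_cls lam reg sU; have hV := rep_cls lam reg sV.
have h1 := rep_cls lam reg s1; have h2 := rep_cls lam reg s2.
have hU' := repM (rep_u1 lam reg d2) h2.
have hV' := repN (repM (rep_v1 lam reg d1) h1).
have cC' i j n := cC n i j.
have E k : k = d4 \/ k = d3 ->
    lie (@jD R lam C reg) (fieldA (alcls lam reg) (becls lam reg) k)
      (vert (cls lam reg z1) (cls lam reg z2)) =1
    lie (@jD R lam C reg) (fieldB (lamcls lam reg) (alcls lam reg)
      (becls lam reg) k)
      (vert (- (cls lam reg V * ivcls lam reg)) (cls lam reg U * iucls lam reg)).
  move=> hk j; have h := zeta k hk j.
  have hS := rep_bracket1 hlam nondeg hk (rep_Sfield h1 h2) j.
  have hR := rep_bracket0 hlam nondeg hk (rep_Rfield nondeg hU hV) j.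
  have [/(_ h) e _] := rep_mod_sys (repB hS hR).
  by apply/eqP; rewrite -subr_eq0 -oppr_eq0 opprB -[X in _ == X]e opprK addrC.
have [l1 l2] : mod_sys lam (linearize (F1 lam) (fun q => uj [:: d2] q * z2 q)
      (fun q => - (vj [:: d1] q * z1 q))) /\
    mod_sys lam (linearize (F2 lam) (fun q => uj [:: d2] q * z2 q)
      (fun q => - (vj [:: d1] q * z1 q))).
  apply/(symop_linearize hlam nondeg cC' hU' hV').
  apply: (symop_recursion (@jD_add _ _ _ reg) (@jD_mul _ _ _ reg) (@D_lamcls _ _ _ _)
    _ (curv1_cls hlam reg nondeg) (curv2_cls hlam reg nondeg)
    (curvB1_cls hlam reg nondeg) (curvB2_cls hlam reg nondeg)
    (E d3 (or_intror erefl)) (E d4 (or_introl erefl))).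
  by move=> x i j; exact: D_comm (cC' i j) x.
by split; [exact: covC|exact: hU'.1|exact: hV'.1|exact: l1|exact: l2].
Qed.

(** * Existence of the nonlocal variables *)

Section Existence.
Variables (R : realType) (lam : 'I_4 -> R) (hlam : injective lam).
Variables (C : covering R) (U V : jetpoint R (nlv C) -> R).

(** The index (b, m, n) stands for the derivative of order (m, n) in (x1, x2) of
    zeta^1 (b = false) or zeta^2 (b = true). *)
Definition zindex : choiceType := (bool * nat * nat)%type.
Local Notation pt' := (jetpoint R (nlv C + zindex)%type).
Local Notation fg := (@forget R C zindex).
Implicit Types (b : bool) (q : pt') (k i j : 'I_4).

(** No condition is imposed on the new variables. *)
Definition zdom : set pt' := fg @^-1` cdom C.

(** The new variable with index (b, m, n). *)
Definition zvar b (m n : nat) : pt' -> R := fun q => q (cw (inr (b, m, n))).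

(** The component of S which holds zeta^1 or zeta^2. *)
Definition zcomp b : 'I_4 := if b then d2 else d1.

(** The derivative of zeta^1 or zeta^2 in x^k, k = 3, 4, as prescribed by the
    relations. *)
Definition zrhs b k : pt' -> R := fun q =>
  Xlax1 lam k d1 (fg q) * zvar b 1 0 q + Xlax1 lam k d2 (fg q) * zvar b 0 1 q
  - (zvar false 0 0 q * Dtot d1 (Xlax1 lam k (zcomp b)) (fg q)
     + zvar true 0 0 q * Dtot d2 (Xlax1 lam k (zcomp b)) (fg q))
  - bracket (Xlax0 lam k) (Rfield U V) (zcomp b) (fg q).

(** Right-hand sides which shift the index for x1 and x2, and are given by F for
    x3 and x4. *)
Definition zrel12 (F : zindex -> 'I_4 -> pt' -> R) (w : zindex) i : pt' -> R :=
  if i == d1 then zvar w.1.1 w.1.2.+1 w.2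
  else if i == d2 then zvar w.1.1 w.1.2 w.2.+1
  else F w i.

(** An auxiliary extension with the correct total derivatives in x1 and x2; those
    are used to prolong the relations for x3 and x4. *)
Definition zcover0 := ext_cover zdom (zrel12 (fun _ _ => fun=> 0)).

(** The relations for the derivatives in x3 and x4 are the total derivatives in x1
    and x2 of those for zeta^1 and zeta^2. *)
Definition zrel : zindex -> 'I_4 -> pt' -> R := zrel12 (fun w i =>
  iter w.1.2 (@Dtot R zcover0 d1) (iter w.2 (@Dtot R zcover0 d2) (zrhs w.1.1 i))).

(** The covering in which zeta^1 and zeta^2 are nonlocal variables. *)
Definition zcover := ext_cover zdom zrel.

Hypothesis sym : nonlocal_symmetry lam C U V.

Let covC : is_covering lam C. Proof. by case: sym. Qed.
Let reg : regular C. Proof. exact: is_covering_regular covC. Qed.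
Let nondeg p : cdom C p -> uj [:: d2] p * vj [:: d1] p != 0.
Proof. by case: covC => _ h _ _; exact: h. Qed.
Let sU : smooth (cdom C) U. Proof. by case: sym. Qed.
Let sV : smooth (cdom C) V. Proof. by case: sym. Qed.

Lemma open_zdom : open zdom.
Proof.
apply: open_comp; last exact: reg.1.
by move=> q _; exact: forget_continuous.
Qed.

Lemma smooth_zvar b m n : smooth zdom (zvar b m n).
Proof. exact: smooth_coord _ open_zdom. Qed.

Lemma zdom_forget q : zdom q -> cdom C (fg q). Proof. by []. Qed.

Let smooth_fg f : smooth (cdom C) f -> smooth zdom (f \o fg).
Proof. exact: (smooth_forget reg open_zdom zdom_forget). Qed.

Let smooth_X k i : k = d4 \/ k = d3 -> smooth (cdom C) (Xlax1 lam k i).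
Proof. by move=> hk; exact: (rep_Xlax1 hlam reg nondeg hk i).1. Qed.

Lemma regular_zcover0 : regular zcover0.
Proof.
apply: (regular_ext reg open_zdom zdom_forget) => w i; rewrite /zrel12.
case: ifP => _; first exact: smooth_zvar.
case: ifP => _; first exact: smooth_zvar.
exact: smooth_cst 0 open_zdom.
Qed.

Let smooth_Y k j : k = d4 \/ k = d3 ->
  smooth (cdom C) (bracket (Xlax0 lam k) (Rfield U V) j).
Proof.
move=> hk.
exact: (rep_bracket0 hlam nondeg hk (rep_Rfield nondeg (rep_cls lam reg sU)
  (rep_cls lam reg sV)) j).1.
Qed.

Lemma smooth_zrhs b k : k = d4 \/ k = d3 -> smooth zdom (zrhs b k).
Proof.
move=> hk; have o := open_zdom.
have sX i := smooth_fg (smooth_X i hk).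
have sDX i j := smooth_fg (smooth_Dtot reg i (smooth_X j hk)).
exact: (smoothB o (smoothB o
  (smoothD o (smoothM o (sX _) (smooth_zvar _ _ _))
             (smoothM o (sX _) (smooth_zvar _ _ _)))
  (smoothD o (smoothM o (smooth_zvar _ _ _) (sDX _ _))
             (smoothM o (smooth_zvar _ _ _) (sDX _ _))))
  (smooth_fg (smooth_Y _ hk))).
Qed.

Lemma iter_smooth_Dtot (C1 : covering R) (r1 : regular C1) i m f :
  smooth (cdom C1) f -> smooth (cdom C1) (iter m (Dtot i) f).
Proof. by move=> sf; elim: m => [|m IH]; [exact: sf|exact: (smooth_Dtot r1 i IH)]. Qed.

Lemma regular_zcover : regular zcover.
Proof.
apply: (regular_ext reg open_zdom zdom_forget) => w i; rewrite /zrel /zrel12.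
have [_|n1] := eqVneq i d1; first exact: smooth_zvar.
have [_|n2] := eqVneq i d2; first exact: smooth_zvar.
apply: (iter_smooth_Dtot regular_zcover0).
apply: (iter_smooth_Dtot regular_zcover0); apply: smooth_zrhs.
by case: (ord4P i) n1 n2 => ->; rewrite ?eqxx//; [right|left].
Qed.

Let reg' := regular_zcover.
Local Notation Q := (jetring lam reg').
Local Notation D := (@jD R lam zcover reg').
Local Notation rp := (@rep R lam zcover reg').
Local Notation L := (lamcls lam reg').
Local Notation al := (alcls lam reg').
Local Notation be := (becls lam reg').

Let nondeg' q : cdom zcover q -> uj [:: d2] q * vj [:: d1] q != 0.
Proof. by move=> Oq; exact: (nondeg (zdom_forget Oq)). Qed.

Let Dtot_fg i f q : smooth (cdom C) f -> zdom q ->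
  @Dtot R zcover i (f \o fg) q = Dtot i f (fg q).
Proof. exact: (Dtot_forget reg zdom_forget reg'). Qed.

Lemma bracket_forget (X Y : vfield C) j q :
  (forall i, smooth (cdom C) (X i)) -> (forall i, smooth (cdom C) (Y i)) ->
  zdom q ->
  @bracket R zcover (fun i => X i \o fg) (fun i => Y i \o fg) j q =
  bracket X Y j (fg q).
Proof.
move=> sX sY Oq; apply: eq_bigr => i _.
by rewrite (Dtot_fg i (sX j) Oq) (Dtot_fg i (sY j) Oq).
Qed.

Let x : Q := cls lam reg' (U \o fg).
Let y : Q := cls lam reg' (V \o fg).
Let r : 'I_4 -> Q := vert (- (y * ivcls lam reg')) (x * iucls lam reg').

Let rep_r i : rp (@Rfield R zcover (U \o fg) (V \o fg) i) (r i).
Proof.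
have hU : rp (U \o fg) x := rep_cls lam reg' (smooth_fg sU).
have hV : rp (V \o fg) y := rep_cls lam reg' (smooth_fg sV).
exact: (@rep_Rfield R lam zcover reg' nondeg' _ _ _ _ hU hV i).
Qed.

Let smooth_Rf i : smooth (cdom C) (Rfield U V i).
Proof.
exact: (rep_Rfield nondeg (rep_cls lam reg sU) (rep_cls lam reg sV) i).1.
Qed.

Let rep_Yfg k j : k = d4 \/ k = d3 ->
  rp (bracket (Xlax0 lam k) (Rfield U V) j \o fg)
     (- lie D (fieldB L al be k) r j).
Proof.
move=> hk; apply: rep_ext (@rep_bracket0 R lam hlam zcover reg' nondeg' k _ r hk rep_r j) => q Oq.
have sX i : smooth (cdom C) (Xlax0 lam k i).
  exact: (rep_Xlax0 hlam reg nondeg hk i).1.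
exact: (bracket_forget j sX smooth_Rf Oq).
Qed.

Let Z b m n : Q := cls lam reg' (zvar b m n).

Let rep_Z b m n : rp (zvar b m n) (Z b m n).
Proof. exact: (@rep_cls R lam zcover reg' _ (smooth_zvar b m n)). Qed.

Let rep_nlrel w i : rp (@nlrel R zcover (inr w) i) (D i (Z w.1.1 w.1.2 w.2)).
Proof.
case: w => -[b m] n.
apply: rep_ext (rep_Dtot i (rep_Z b m n)) => q Oq.
exact: (Dtot_coord reg' i _ Oq).
Qed.

Let DZ1 b m n : D d1 (Z b m n) = Z b m.+1 n.
Proof. exact: rep_fun (rep_nlrel (b, m, n) d1) (rep_Z _ _ _). Qed.

Let DZ2 b m n : D d2 (Z b m n) = Z b m n.+1.
Proof. exact: rep_fun (rep_nlrel (b, m, n) d2) (rep_Z _ _ _). Qed.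

Lemma Dtot_zcover0 i f : i = d1 \/ i = d2 ->
  @Dtot R zcover0 i f = @Dtot R zcover i f.
Proof.
move=> hi; apply/funext => q; apply: eq_fsbigr => c _; congr (_ * _).
by case: c => [j|a|a|[n|w]] //; case: hi => ->.
Qed.

Let rep_iter i m f (t : Q) : rp f t ->
  rp (iter m (@Dtot R zcover i) f) (iter m (D i) t).
Proof. by move=> h; elim: m => [|m IH]; [exact: h|exact: (rep_Dtot i IH)]. Qed.

Let rep_zrhs b k : k = d4 \/ k = d3 -> rp (zrhs b k) (D k (Z b 0 0)).
Proof.
move=> hk; have := rep_nlrel (b, 0%N, 0%N) k.
by case: hk => ->.
Qed.

Let DZk b m n k : k = d4 \/ k = d3 ->
  D k (Z b m n) = iter m (D d1) (iter n (D d2) (D k (Z b 0 0))).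
Proof.
move=> hk; apply: rep_fun (rep_nlrel (b, m, n) k) _.
have -> : @nlrel R zcover (inr (b, m, n)) k =
    iter m (@Dtot R zcover d1) (iter n (@Dtot R zcover d2) (zrhs b k)).
  have e1 : @Dtot R zcover0 d1 = @Dtot R zcover d1.
    by apply/funext => f; apply: Dtot_zcover0; left.
  have e2 : @Dtot R zcover0 d2 = @Dtot R zcover d2.
    by apply/funext => f; apply: Dtot_zcover0; right.
  by rewrite -e1 -e2; case: hk => ->.
exact: rep_iter (rep_iter _ _ (rep_zrhs b hk)).
Qed.

Let S : 'I_4 -> Q := vert (Z false 0 0) (Z true 0 0).

(** The relations for zeta hold in the quotient ring, by the choice of zrhs. *)
Lemma zeta_eq k : k = d4 \/ k = d3 ->
  lie D (fieldA al be k) S =1 lie D (fieldB L al be k) r.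
Proof.
move=> hk.
have hX i : rp (Xlax1 lam k i \o fg) (- fieldA al be k i).
  exact: (rep_Xlax1 hlam reg' nondeg' hk i).
have hDX i j : rp (Dtot i (Xlax1 lam k j) \o fg) (D i (- fieldA al be k j)).
  apply: rep_ext (rep_Dtot i (hX j)) => q Oq.
  exact: (Dtot_fg i (smooth_X j hk) Oq).
have e b : D k (Z b 0 0) = - fieldA al be k d1 * Z b 1 0
    + - fieldA al be k d2 * Z b 0 1
    - (Z false 0 0 * D d1 (- fieldA al be k (zcomp b))
       + Z true 0 0 * D d2 (- fieldA al be k (zcomp b)))
    - (- lie D (fieldB L al be k) r (zcomp b)).
  apply: rep_fun (rep_zrhs b hk) _.
  exact: (repB (repB
    (repD (repM (hX _) (rep_Z _ _ _)) (repM (hX _) (rep_Z _ _ _)))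
    (repD (repM (rep_Z _ _ _) (hDX _ _)) (repM (rep_Z _ _ _) (hDX _ _))))
    (rep_Yfg _ hk)).
have DN := derN (@jD_add R lam zcover reg').
have lieS := lie_horiz_vert (@jD_add R lam zcover reg') (al k) (be k)
  (Z false 0 0) (Z true 0 0) hk (der1 (@jD_mul R lam zcover reg') _)
  (der1 (@jD_mul R lam zcover reg') _).
have lieR := lie_horiz_vert (@jD_add R lam zcover reg') (L d1 * al k)
  (L d2 * be k) (- (y * ivcls lam reg')) (x * iucls lam reg') hk
  (D_lamcls _ _ d1 k) (D_lamcls _ _ d2 k).
move=> j; case: (ord4P j) => ->.
- rewrite lieS /vert /= (dirder_horiz _ _ _ _ _ hk) DZ1 DZ2.
  by apply: solve_transport; rewrite [LHS](e false) !DN.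
- rewrite lieS /vert /= (dirder_horiz _ _ _ _ _ hk) DZ1 DZ2.
  by apply: solve_transport; rewrite [LHS](e true) !DN.
- by rewrite lieS lieR.
- by rewrite lieS lieR.
Qed.

Let cC i j n : mod_sys lam (Dtot i (nlrel C n j) \- Dtot j (nlrel C n i)).
Proof. by case: covC => _ _ _; apply. Qed.

(** On functions lifted from C the derivations commute, C being a covering. *)
Lemma commute_forget f : smooth (cdom C) f -> commute_on D (cls lam reg' (f \o fg)).
Proof.
move=> sf i j.
have h k l : rp (Dtot k (Dtot l f) \o fg) (D k (D l (cls lam reg' (f \o fg)))).
  have h1 : rp (Dtot l f \o fg) (D l (cls lam reg' (f \o fg))).
    apply: rep_ext (rep_Dtot l (@rep_cls R lam zcover reg' _ (smooth_fg sf))) => q Oq.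
    exact: (Dtot_fg l sf Oq).
  apply: rep_ext (rep_Dtot k h1) => q Oq.
  exact: (Dtot_fg k (smooth_Dtot reg l sf) Oq).
have m := mod_sys_forget reg open_zdom zdom_forget reg'
  (mod_sys_comm reg (cC i j) sf).
have [e _] := rep_mod_sys (repB (h i j) (h j i)).
by apply/eqP; rewrite -subr_eq0; apply/eqP; exact: e m.
Qed.

Let commute_al k : commute_on D (al k).
Proof.
have [sf _] := @rep_al R lam C reg nondeg k.
by have [_ <-] := @rep_al R lam zcover reg' nondeg' k; exact: commute_forget sf.
Qed.

Let commute_be k : commute_on D (be k).
Proof.
have [sf _] := @rep_be R lam hlam C reg nondeg k.
by have [_ <-] := @rep_be R lam hlam zcover reg' nondeg' k; exact: commute_forget sf.
Qed.

Let commZ i j := forall b m n, D i (D j (Z b m n)) = D j (D i (Z b m n)).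

Lemma mod_sys_zcover i j : commZ i j -> forall n,
  mod_sys lam (@Dtot R zcover i (@nlrel R zcover n j) \-
               @Dtot R zcover j (@nlrel R zcover n i)).
Proof.
move=> cZ [n|w].
  have m := mod_sys_forget reg open_zdom zdom_forget reg' (cC i j n).
  apply: mod_ext m => q Oq /=.
  by rewrite (Dtot_fg i (reg.2 n j) Oq) (Dtot_fg j (reg.2 n i) Oq).
have [_ e] := rep_mod_sys (repB (rep_Dtot i (rep_nlrel w j))
                                (rep_Dtot j (rep_nlrel w i))).
by apply: e; rewrite cZ subrr.
Qed.

Let commD i j : commZ i j -> forall t : Q, D i (D j t) = D j (D i t).
Proof. by move=> /mod_sys_zcover; exact: D_comm. Qed.

Let h3 : d3 = d4 \/ d3 = d3 := or_intror erefl.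
Let h4 : d4 = d4 \/ d4 = d3 := or_introl erefl.

(** E vanishes on R over the extension: it does so over C, where (U, V) is a
    symmetry, and the differential ideal of C lifts. *)
Lemma symop_r : symop D L al be r =1 fun=> 0.
Proof.
pose Y k : vfield C := bracket (Xlax0 lam k) (Rfield U V).
pose T j := fun p : jetpoint R (nlv C) =>
  bracket (Xlax1 lam d3) (Y d4) j p - bracket (Xlax1 lam d4) (Y d3) j p.
move=> j.
have mT : mod_sys lam (T j).
  pose xC := cls lam reg U; pose yC := cls lam reg V.
  pose r1 := - (yC * ivcls lam reg); pose r2 := xC * iucls lam reg.
  have hU : @rep R lam C reg U xC := rep_cls lam reg sU.
  have hV : @rep R lam C reg V yC := rep_cls lam reg sV.
  have hR := @rep_Rfield R lam C reg nondeg _ _ _ _ hU hV.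
  have hY k (hk : k = d4 \/ k = d3) := @rep_bracket0 R lam hlam C reg nondeg k _ _ hk hR.
  have e : symop (@jD R lam C reg) (lamcls lam reg) (alcls lam reg) (becls lam reg)
      (vert r1 r2) =1 fun=> 0.
    have eU : @jD R lam C reg d2 (ucls lam reg) * r2 = xC.
      exact: (mulr_cancel_inv _ (@iuclsP R lam C reg nondeg)).
    have eV : - (@jD R lam C reg d1 (vcls lam reg) * r1) = yC.
      rewrite /r1 mulrN opprK.
      exact: (mulr_cancel_inv _ (@ivclsP R lam C reg nondeg)).
    apply/(@symop_linearize R lam hlam C reg nondeg U V r1 r2).
    - by move=> i' j' n; exact: cC.
    - by rewrite eU.
    - by rewrite eV.
    - by case: sym.
  have hT := repB (@rep_bracket1 R lam hlam C reg nondeg d3 _ _ h3 (hY d4 h4) j)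
                  (@rep_bracket1 R lam hlam C reg nondeg d4 _ _ h4 (hY d3 h3) j).
  apply/(rep_mod_sys hT); rewrite -[RHS](e j).
  exact: (symop_opp (@jD_add R lam C reg)).
have mT' := mod_sys_forget reg open_zdom zdom_forget reg' mT.
have hY k (hk : k = d4 \/ k = d3) i := @rep_Yfg k i hk.
have hT : rp (T j \o fg) (symop D L al be r j).
  apply: (rep_eq (x := - lie D (fieldA al be d3) (fun i => - lie D (fieldB L al be d4) r i) j
    - - lie D (fieldA al be d4) (fun i => - lie D (fieldB L al be d3) r i) j)).
    apply: rep_ext (repB
      (@rep_bracket1 R lam hlam zcover reg' nondeg' d3 _ _ h3 (hY d4 h4) j)
      (@rep_bracket1 R lam hlam zcover reg' nondeg' d4 _ _ h4 (hY d3 h3) j)).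
    move=> q Oq.
    have e k l (hk : k = d4 \/ k = d3) (hl : l = d4 \/ l = d3) :=
      @bracket_forget (Xlax1 lam k) (Y l) j q (fun i => smooth_X i hk)
         (fun i => smooth_Y i hl) Oq.
    by congr (_ - _); [exact: e d3 d4 h3 h4|exact: e d4 d3 h4 h3].
  exact: (symop_opp (@jD_add R lam zcover reg')).
by have [e _] := rep_mod_sys hT; exact: e mT'.
Qed.

Lemma commZ_all i j : commZ i j.
Proof.
exact: (prolongation_commute (@jD_add R lam zcover reg') (@jD_mul R lam zcover reg')
  commute_al commute_be (curv1_cls hlam reg' nondeg') (curv2_cls hlam reg' nondeg')
  zeta_eq symop_r DZ1 DZ2 DZk commD).
Qed.

Lemma zcover_over : covering_over lam zdom zrel.
Proof.
split.
  split; [exact: open_zdom|exact: nondeg'|exact: reg'.2|].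
  by move=> n i j; exact: mod_sys_zcover (commZ_all i j) n.
apply/seteqP; split=> [_ [q Oq <-]//|p Op].
pose q : pt' := fun c => match c with
  | cx i => p (cx i) | cu a => p (cu a) | cv a => p (cv a)
  | cw (inl n) => p (cw n) | cw (inr _) => 0 end.
have qp : fg q = p by apply/funext => -[].
by exists q; rewrite /zdom /= ?qp.
Qed.

Lemma zcover_zeta : zeta_relations lam zcover (U \o fg) (V \o fg)
  (zvar false 0 0) (zvar true 0 0).
Proof.
move=> k hk j.
have hS := @rep_bracket1 R lam hlam zcover reg' nondeg' k _ _ hk
  (rep_Sfield (rep_Z false 0 0) (rep_Z true 0 0)) j.
have hR := @rep_bracket0 R lam hlam zcover reg' nondeg' k _ _ hk rep_r j.
have [_ e] := rep_mod_sys (repB hS hR).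
by apply: e; rewrite -/S (zeta_eq hk) subrr.
Qed.

End Existence.

Theorem proposition2 (R : realType) (lam : 'I_4 -> R) (hlam : injective lam)
    (C : covering R) (U V : jetpoint R (nlv C) -> R)
    (hUV : nonlocal_symmetry lam C U V) :
  (* the relations define nonlocal variables zeta^1, zeta^2 over the covering *)
  (exists (M : choiceType) (Om : set (jetpoint R (nlv C + M)%type))
          (W : M -> 'I_4 -> jetpoint R (nlv C + M)%type -> R) (m1 m2 : M),
     [/\ m1 != m2, covering_over lam Om W
       & zeta_relations lam (ext_cover Om W)
           (U \o forget C M) (V \o forget C M)
           (fun q => q (cw (inr m1))) (fun q => q (cw (inr m2)))]) /\
  (* whenever zeta^1, zeta^2 satisfy the relations, the new flow is a symmetry *)
  (forall (M : choiceType) (Om : set (jetpoint R (nlv C + M)%type))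
          (W : M -> 'I_4 -> jetpoint R (nlv C + M)%type -> R)
          (zeta1 zeta2 : jetpoint R (nlv C + M)%type -> R),
     covering_over lam Om W -> smooth Om zeta1 -> smooth Om zeta2 ->
     zeta_relations lam (ext_cover Om W)
       (U \o forget C M) (V \o forget C M) zeta1 zeta2 ->
     nonlocal_symmetry lam (ext_cover Om W)
       (fun q => uj [:: d2] q * zeta2 q)
       (fun q => - (vj [:: d1] q * zeta1 q))).
Proof.
split.
  exists zindex, (@zdom R C), (zrel lam U V), (false, 0%N, 0%N), (true, 0%N, 0%N).
  by split; [|exact: (zcover_over hlam hUV)|exact: (zcover_zeta hlam hUV)].
move=> M Om W zeta1 zeta2 [covC' domC] s1 s2 zeta.
have [covC sU sV _ _] := hUV; have reg := is_covering_regular covC.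
have oOm : open Om by case: covC'.
have dom q : Om q -> cdom C (forget C M q) by rewrite -domC => Oq; exists q.
have lift f : smooth (cdom C) f -> smooth Om (f \o forget C M).
  exact: (smooth_forget reg oOm dom).
exact: (@new_symmetry R lam hlam (ext_cover Om W) _ _ _ _ covC'
  (lift U sU) (lift V sV) s1 s2 zeta).
Qed.
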